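(* Let $d\in\mathbb{N}$ and let the random vector $\boldsymbol{U}=(U_1,\dots,U_d)$ follow a copula $C$ on $\mathbb{R}^d$. Then $C$ is a generalized Pareto copula if and only if for each nonempty subset $T=\{i_1,\dots,i_m\}$ of $\{1,\dots,d\}$ the random vector $\boldsymbol{U}_T=(U_{i_1},\dots,U_{i_m})$ is exceedance stable, i.e., there exists $\varepsilon_T>0$ such that $$P\left(\boldsymbol{U}_T\ge \boldsymbol{1}-t\boldsymbol{u}\right)=t\,P\left(\boldsymbol{U}_T\ge \boldsymbol{1}-\boldsymbol{u}\right)\qquad\text{for all } t\in[0,1] \text{ and all } \boldsymbol{u}\in[0,\varepsilon_T]^m .$$
   Context: All operations and inequalities between vectors are meant componentwise; $\boldsymbol{1}=(1,\dots,1)$ and $\boldsymbol{0}=(0,\dots,0)$ in the appropriate dimension. A copula on $\mathbb{R}^d$ is the distribution function of a random vector each of whose components is uniformly distributed on $(0,1)$. A norm $\|\cdot\|_D$ on $\mathbb{R}^d$ is called a $D$-norm if there exists a random vector $\boldsymbol{Z}=(Z_1,\dots,Z_d)$, called a generator of $\|\cdot\|_D$, with $Z_i\ge 0$ and $E(Z_i)=1$ for $1\le i\le d$, such that $$\|\boldsymbol{x}\|_D=E\left(\max_{1\le i\le d}\left(|x_i|Z_i\right)\right),\qquad \boldsymbol{x}=(x_1,\dots,x_d)\in\mathbb{R}^d .$$ A copula $C$ on $\mathbb{R}^d$ is called a generalized Pareto copula (GPC) if there exist a $D$-norm $\|\cdot\|_D$ on $\mathbb{R}^d$ and a vector $\boldsymbol{u}_0\in\mathbb{R}^d$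 with $\boldsymbol{0}<\boldsymbol{u}_0<\boldsymbol{1}$ such that $$C(\boldsymbol{u})=1-\|\boldsymbol{1}-\boldsymbol{u}\|_D\qquad\text{for all }\boldsymbol{u}\in[\boldsymbol{u}_0,\boldsymbol{1}]=\{\boldsymbol{u}\in\mathbb{R}^d:\boldsymbol{u}_0\le\boldsymbol{u}\le\boldsymbol{1}\}.$$ *)

(* Defs.v *)
From HB Require Import structures.
From mathcomp Require Import all_boot all_order all_algebra.
From mathcomp Require Import all_classical all_reals all_analysis.

Set Implicit Arguments.
Unset Strict Implicit.
Unset Printing Implicit Defensive.

Import Order.TTheory GRing.Theory Num.Theory.

Local Open Scope classical_set_scope.
Local Open Scope ring_scope.

(* Points of R^d are row vectors; a d-dimensional random vector on the
   probability space (T, P) is a family X : 'I_d -> {RV P >-> R} of real random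
   variables, which amounts to a single measurable map into R^d. *)

Section random_vectors.
Context {disp : measure_display} {T : measurableType disp} {R : realType}
  {P : probability T R}.

Definition joint_cdf (d : nat) (X : 'I_d -> {RV P >-> R}) (u : 'rV[R]_d)
    : \bar R :=
  P [set w | forall i, X i w <= u 0 i].

Definition uniform01 (X : {RV P >-> R}) : Prop :=
  forall A : set R, measurable A ->
    distribution P X A = uniform_prob (@ltr01 R) A.

(* The components are listed in increasing order of their index in S. *)
Definition subvector (d : nat) (X : 'I_d -> {RV P >-> R}) (S : {set 'I_d})
    : 'I_#|S| -> {RV P >-> R} :=
  fun j => X (enum_val j).

Definition exceedance_stable (m : nat) (X : 'I_m -> {RV P >-> R}) : Prop :=
  exists2 eps : R, 0 < eps &
    forall (t : R) (u : 'rV[R]_m),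
      0 <= t <= 1 ->
      (forall i, 0 <= u 0 i <= eps) ->
      P [set w | forall i, 1 - t * u 0 i <= X i w] =
      (t%:E * P [set w | forall i, (1 - u 0 i <= X i w)%R])%E.

End random_vectors.

Arguments subvector {disp T R P d} X S.

Definition is_copula (R : realType) (d : nat) (C : 'rV[R]_d -> R) : Prop :=
  exists (disp : measure_display) (T : measurableType disp)
         (P : probability T R) (U : 'I_d -> {RV P >-> R}),
    (forall i, uniform01 (U i)) /\
    (forall u, joint_cdf U u = (C u)%:E).

Definition is_norm (R : realType) (d : nat) (N : 'rV[R]_d -> R) : Prop :=
  [/\ forall x, 0 <= N x,
      forall x, N x = 0 -> x = 0,
      forall (a : R) x, N (a *: x) = `|a| * N x &
      forall x y, N (x + y) <= N x + N y].

(* All the terms of the maximum are nonnegative, so that starting the iterated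
   maximum from 0 does not change its value (for 0 < d). *)
Definition is_generator (R : realType) (d : nat) (N : 'rV[R]_d -> R)
    (disp : measure_display) (T : measurableType disp) (P : probability T R)
    (Z : 'I_d -> {RV P >-> R}) : Prop :=
  [/\ forall i w, 0 <= Z i w,
      forall i, ('E_P[Z i] = 1)%E &
      forall x : 'rV[R]_d,
        ((N x)%:E =
         'E_P[fun w => (\big[Num.max/0]_(i < d) (`|x 0 i| * Z i w))%R])%E].

Definition is_Dnorm (R : realType) (d : nat) (N : 'rV[R]_d -> R) : Prop :=
  is_norm N /\
  exists (disp : measure_display) (T : measurableType disp)
         (P : probability T R) (Z : 'I_d -> {RV P >-> R}),
    is_generator N Z.

Definition is_GPC (R : realType) (d : nat) (C : 'rV[R]_d -> R) : Prop :=
  is_copula C /\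
  exists (N : 'rV[R]_d -> R) (u0 : 'rV[R]_d),
    [/\ is_Dnorm N,
        forall i, 0 < u0 0 i < 1 &
        forall u : 'rV[R]_d, (forall i, u0 0 i <= u 0 i <= 1) ->
          C u = 1 - N (const_mx 1 - u)].

(* Main.v *)
Require Import Defs.
From HB Require Import structures.
From mathcomp Require Import all_boot all_order all_algebra.
From mathcomp Require Import all_classical all_reals all_analysis.
From mathcomp Require Import measurable_realfun ring lra.

(** Put V_i = 1 - U_i.  Everything turns on the probabilities of the boxes
    {V_i <= x_i for i in A, V_j > x_j for j in B}, with x near 0.  Splitting
    such an event according to the side on which one more coordinate falls
    gives a recursion, [pbox_split], which carries homogeneity in x from one
    family of boxes to the other: the boxes with A nonempty and B empty scale
    linearly if and only if those with A empty do so up to the constant 1 - t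
    ([box_homogeneous_ge], [box_homogeneous_lt]).  The former are the events
    of exceedance stability; the latter have probability C(1 - x_B), since the
    margins of a copula have no atoms.

    If C is a generalized Pareto copula, then C(1 - x_B) = 1 - N(x_B) for a norm
    N, and homogeneity of N yields exceedance stability
    ([gpc_exceedance_stable]).

    Conversely, exceedance stability makes tail(x) = P(V_i <= x_i for some i)
    = 1 - C(1 - x) homogeneous near 0, and what has to be built is a generator
    Z with E(max x_i Z_i) = tail(x).  It comes from the exponent measure of the
    reciprocals Y_i = 1/V_i, that is, from the limit of the measures
    2^n P(2^-n Y in .) away from the origin.  Reciprocals at which V_i lies
    outside the homogeneous regime are replaced by 0.  Since exceedance
    stability determines the law of the resulting vector on orthants, it says
    that away from the origin this law is reproduced, with weight 1/2, by
    halving the vector and erasing the coordinates that become too small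
    ([reciprocal_halve]).  Hence
    two consecutive approximations of the exponent measure differ only on the
    event that a coordinate has just been revealed; the masses of these events
    telescope, so the approximations converge in total variation and the limit
    is a measure L ([finite_measure_limit], [exponent_measure]), with
    L(2 B) = L(B)/2 and L{y | max x_i y_i >= 1} = tail(x) for small x.

    Under the normalization of L, the generator Z(y) is a multiple of the
    positive part of y on the dyadic shell h <= max y_i < 2 h, and 0 elsewhere.
    Indeed, average L{y | max x_i y_i >= s} = tail(x)/s over s in [1, 2], and
    cut the space into the images of that shell under the dilations by 2^n,
    which carry copies of the same measure with weight 2^-n: the result is the
    integral of max x_i y_i over the shell, equal to tail(x) ln 2
    ([spectral_integral]). *)

Set Implicit Arguments.
Unset Strict Implicit.
Unset Printing Implicit Defensive.
Import Order.TTheory GRing.Theory Num.Theory.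
Import numFieldNormedType.Exports.
Local Open Scope classical_set_scope.
Local Open Scope ring_scope.

(** * Limits of measures in total variation *)

(** The increments of [c] bound the increments of [mu] uniformly over all
    measurable sets, and [c] is bounded, so that [mu] is a Cauchy sequence in
    total variation. *)
Section total_variation_limit.
Context {disp : measure_display} {T : measurableType disp} {R : realType}.
Variables (mu : {measure set T -> \bar R}^nat) (c : R^nat) (M : R).
Hypothesis mu_fin : forall n, fin_num_fun (mu n).
Hypothesis step : forall n A, measurable A ->
  `|fine (mu n.+1 A) - fine (mu n A)| <= c n.+1 - c n.
Hypothesis cM : forall n, c n <= M.

Let c_nd : nondecreasing_seq c.
Proof.
apply/nondecreasing_seqP => n; rewrite -subr_ge0.
exact: le_trans (step n measurable0).
Qed.

Let c_cvg : cvgn c.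
Proof.
apply: nondecreasing_is_cvgn => //.
by exists M => _ [n _ <-]; exact: cM.
Qed.

Let gap n m A : (n <= m)%N -> measurable A ->
  `|fine (mu m A) - fine (mu n A)| <= c m - c n.
Proof.
move=> nm mA; rewrite -(subnKC nm); elim: (m - n)%N => [|k IH].
  by rewrite addn0 !subrr normr0.
rewrite addnS.
have -> : fine (mu (n + k).+1 A) - fine (mu n A) =
  (fine (mu (n + k).+1 A) - fine (mu (n + k)%N A)) +
  (fine (mu (n + k)%N A) - fine (mu n A)) by rewrite subrKA.
apply: le_trans (ler_normD _ _) _.
by have := step (n + k)%N mA; lra.
Qed.

(* The sequence mu_n(A) + c_n is nondecreasing, since the increments of c
   compensate the possible decrease of mu_n(A). *)
Let mu_cvg A : measurable A -> cvgn (fun n => fine (mu n A)).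
Proof.
move=> mA.
suff h : cvgn (fun n => fine (mu n A) + c n).
  have -> : (fun n => fine (mu n A)) = (fun n => (fine (mu n A) + c n) - c n).
    by apply/funext => n; rewrite addrK.
  exact: is_cvgB.
apply: nondecreasing_is_cvgn.
  apply/nondecreasing_seqP => n; have := step n mA.
  by rewrite ler_norml => /andP[+ _]; lra.
exists (fine (mu 0%N A) + (M - c 0%N) + M) => _ [n _ <-]; rewrite lerD//.
have := gap (leq0n n) mA; rewrite ler_norml => /andP[_]; have := cM n; lra.
Qed.

Let l A := limn (fun n => fine (mu n A)).

Let l_gap n A : measurable A -> `|l A - fine (mu n A)| <= limn c - c n.
Proof.
move=> mA.
have h1 : (fun m => `|fine (mu m A) - fine (mu n A)|) @ \oo -->
          `|l A - fine (mu n A)|.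
  by apply: cvg_norm; apply: cvgB; [exact: mu_cvg|exact: cvg_cst].
have h2 : (fun m => c m - c n) @ \oo --> limn c - c n.
  by apply: cvgB => //; exact: cvg_cst.
rewrite -(cvg_lim _ h1)// -(cvg_lim _ h2)//; apply: ler_lim.
- by apply/cvg_ex; eexists; exact: h1.
- by apply/cvg_ex; eexists; exact: h2.
- by near=> m; apply: gap => //; near: m; exact: nbhs_infty_ge.
Unshelve. all: by end_near. Qed.

Let l_ge0 A : measurable A -> 0 <= l A.
Proof.
by move=> mA; apply: limr_ge; [exact: mu_cvg|near=> n; exact: fine_ge0].
Unshelve. all: by end_near. Qed.

(* The limit is set to 0 off the measurable sets, where the sequence may
   diverge, because a measure is nonnegative on all sets. *)
Let nu A : \bar R := if `[< measurable A >] then (l A)%:E else 0%E.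

Let nuE A : measurable A -> nu A = (l A)%:E.
Proof. by move=> mA; rewrite /nu asboolT. Qed.

Let nu0 : nu set0 = 0%E.
Proof.
rewrite nuE// /l; congr EFin; under eq_fun do rewrite measure0/=.
exact: lim_cst.
Qed.

Let nu_ge0 A : (0 <= nu A)%E.
Proof.
rewrite /nu; case: ifPn => // /asboolP mA.
by rewrite lee_fin l_ge0.
Qed.

Let l_sum (F : (set T)^nat) n : (forall i, measurable (F i)) ->
  trivIset setT F -> \sum_(0 <= i < n) l (F i) = l (\big[setU/set0]_(i < n) F i).
Proof.
move=> mF tF; apply/esym/cvg_lim => //.
rewrite (_ : (fun k => _) = (fun k => \sum_(0 <= i < n) fine (mu k (F i)))).
  by apply: cvg_big => [|i _]; [exact: add_continuous|exact: mu_cvg].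
apply/funext => k; rewrite measure_bigsetU// -sum_fine ?big_mkord//.
by move=> i _; rewrite mu_fin.
Qed.

Let nu_sigma : semi_sigma_additive nu.
Proof.
move=> F mF tF mU; rewrite nuE//.
rewrite (_ : (fun n => _) =
  EFin \o (fun n => l (\big[setU/set0]_(i < n) F i))); last first.
  apply/funext => n /=; rewrite -l_sum// -sumEFin.
  by apply: eq_bigr => i _; rewrite nuE.
apply: cvg_EFin; first exact: nearW.
rewrite (_ : fine \o _ = (fun n => l (\big[setU/set0]_(i < n) F i))) //.
apply/cvgrPdist_lt => e e0.
have e3 : 0 < e / 3%:R by rewrite divr_gt0.
(* Fix k with total variation error below e / 3, then use countable
   additivity of mu_k. *)
have /cvgrPdist_lt/(_ _ e3)[k _ /(_ k (leqnn k))/= hk] := c_cvg.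
have mUn n : measurable (\big[setU/set0]_(i < n) F i).
  by apply: bigsetU_measurable => i _.
have := @measure_semi_sigma_additive _ _ _ (mu k) F mF tF mU.
rewrite (_ : (fun n => _) = (fun n => mu k (\big[setU/set0]_(i < n) F i)));
  last by apply/funext => n; rewrite measure_bigsetU// big_mkord.
rewrite -[X in _ --> X]fineK ?mu_fin//.
move=> /fine_cvg/cvgrPdist_lt/(_ _ e3)[N _ hN].
exists N => // n /= Nn.
have := hN n Nn; rewrite /=.
have := l_gap k mU; have := l_gap k (mUn n).
have hk' : limn c - c k < e / 3%:R by apply: le_lt_trans hk; exact: ler_norm.
rewrite !ler_norml !ltr_norml => /andP[a1 a2] /andP[b1 b2] /andP[d1 d2].
apply/andP; split; lra.
Qed.

(** The limit is countably additive because the error of approximating it by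
    mu_k is the same for a union and for all its finite subunions. *)
Lemma finite_measure_limit : exists nu : {finite_measure set T -> \bar R},
  forall A, measurable A -> mu n A @[n --> \oo] --> nu A.
Proof.
pose nuM := isMeasure.Build _ _ _ nu nu0 nu_ge0 nu_sigma.
pose mnu : {measure set T -> \bar R} := HB.pack nu nuM.
have fnu : fin_num_fun mnu by move=> A mA; rewrite /= nuE.
pose fmnu : {finite_measure set T -> \bar R} :=
  HB.pack nu nuM (Measure_isFinite.Build _ _ _ mnu fnu).
exists fmnu => A mA /=; rewrite nuE//.
apply: cvg_EFin; first by apply: nearW => n; rewrite mu_fin.
exact: mu_cvg.
Qed.

End total_variation_limit.

(** * Margins of a copula *)

Lemma measure_ae_eq d (T : measurableType d) (R : realType)
    (mu : {measure set T -> \bar R}) (A B : set T) :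
  measurable A -> measurable B -> {ae mu, forall w, A w <-> B w} ->
  mu A = mu B.
Proof.
move=> mA mB [N [mN N0 AB]].
have h A' B' : measurable A' -> measurable B' ->
    (forall w, ~ N w -> A' w -> B' w) -> (mu A' <= mu B')%E.
  move=> mA' mB' AB'; rewrite -(measureU0 mB' mN N0).
  apply: le_measure; rewrite ?inE//; first exact: measurableU.
  by move=> w A'w; case: (pselect (N w)) => [|/AB']; [right|left; auto].
have NAB w : ~ N w -> (A w <-> B w).
  by move=> Nw; apply: contrapT => /AB.
by apply/eqP; rewrite eq_le; apply/andP; split; apply: h => // w /NAB [].
Qed.

Section margins.
Context {d1 d2 : measure_display} {T1 : measurableType d1}
  {T2 : measurableType d2} {R : realType}.

Lemma cdf_inj_distribution (P1 : probability T1 R) (P2 : probability T2 R)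
    (X1 : {RV P1 >-> R}) (X2 : {RV P2 >-> R}) :
  cdf X1 =1 cdf X2 ->
  forall A, measurable A -> distribution P1 X1 A = distribution P2 X2 A.
Proof.
move=> h A mA.
apply: (@g_sigma_algebra_measure_unique _ R _ (@measurable_realfun.RGenOInfty.G R)
  _ (fun n => `](- n%:R), +oo[%classic)).
- by move=> _ [x ->]; exact: measurable_itv.
- by move=> n; exists (- n%:R).
- apply/seteqP; split => // x _.
  exists (Num.bound `|x|) => //=; rewrite in_itv/= andbT ltrNl.
  by rewrite (le_lt_trans _ (archi_boundP (normr_ge0 x)))// ler_normr lexx orbT.
- move=> _ _ [x ->] [y ->]; exists (Num.max x y).
  apply/seteqP; split=> z /=; rewrite !in_itv/= !andbT gt_max.
    by case=> -> ->.
  by case/andP.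
- move=> _ [x ->]; have := ccdf_1_cdf X1 x.
  by rewrite h -(ccdf_1_cdf X2 x).
- by move=> n; rewrite ltey_eq fin_num_measure.
- suff -> : <<s @measurable_realfun.RGenOInfty.G R >> = @measurable _ R by [].
  exact: (esym (@measurable_realfun.RGenOInfty.measurableE R)).
Qed.

End margins.

Section uniform_margins.
Context {R : realType} {disp : measure_display} {T : measurableType disp}
  {P : probability T R}.

Lemma uniform01_le1 (X : {RV P >-> R}) :
  uniform01 X -> P [set w | X w <= 1] = 1%E.
Proof.
move=> uX.
rewrite (_ : [set w | X w <= 1] = X @^-1` `]-oo, 1]); last first.
  by apply/seteqP; split=> w /=; rewrite in_itv.
rewrite [LHS](uX `]-oo, 1]%classic (measurable_itv _)).
rewrite /uniform_prob integral_uniform_pdf1//.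
by move=> x /=; rewrite !in_itv/= => /andP[].
Qed.

Lemma uniform01_neq (X : {RV P >-> R}) c :
  uniform01 X -> {ae P, forall w, X w != c}.
Proof.
move=> uX; have := uX [set c] (measurable_set1 _).
have /null_content_dominatesP dom := dominates_uniform_prob (@ltr01 R).
rewrite dom//; last exact: lebesgue_measure_set1.
rewrite /distribution /pushforward/= => h.
exists (X @^-1` [set c]); split => //.
by move=> w /= /negP; rewrite negbK => /eqP.
Qed.

Lemma uniform01_ae_le1 (X : {RV P >-> R}) :
  uniform01 X -> {ae P, forall w, X w <= 1}.
Proof.
move=> uX; exists (~` [set w | X w <= 1]).
have mX : measurable [set w | X w <= 1].
  rewrite (_ : [set w | _] = X @^-1` `]-oo, 1]).
    exact: measurable_funPTI.
  by apply/seteqP; split=> w /=; rewrite in_itv.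
split => //; first exact: measurableC.
by rewrite probability_setC// uniform01_le1// subee.
Qed.

Lemma uniform01_ge (X : {RV P >-> R}) v : 0 <= v <= 1 ->
  uniform01 X -> P [set w | 1 - v <= X w] = v%:E.
Proof.
move=> /andP[v0 v1] uX.
rewrite (_ : [set w | 1 - v <= X w] = X @^-1` `[1 - v, +oo[); last first.
  by apply/seteqP; split=> w /=; rewrite in_itv/= andbT.
rewrite [LHS](uX `[1 - v, +oo[%classic (measurable_itv _)).
rewrite /uniform_prob integral_uniform_pdf.
rewrite (_ : _ `&` _ = `[1 - v, 1]%classic); last first.
  apply/seteqP; split=> x /=; rewrite !in_itv/= ?andbT.
    by case=> -> /andP[].
  by move=> /andP[h ->]; split => //; rewrite andbT (le_trans _ h)// subr_ge0.
rewrite (eq_integral (fun=> 1%E)); last first.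
  move=> x; rewrite inE/= in_itv/= /uniform_pdf => /andP[h ->].
  by rewrite (le_trans _ h) ?subr_ge0// subr0 invr1.
rewrite integral_cst//= mul1e lebesgue_measure_itv/= lte_fin.
case: ltP => h; first by rewrite -EFinB opprB addrCA subrr addr0.
by have -> : v = 0 by lra.
Qed.


End uniform_margins.

Lemma ae_forall_fin d (T : measurableType d) (R : realType)
    (mu : {measure set T -> \bar R}) (I : finType) (Q : I -> T -> Prop) :
  (forall i, {ae mu, forall w, Q i w}) -> {ae mu, forall w i, Q i w}.
Proof. by move=> h; exact: filter_forall. Qed.

Lemma measurable_forall_fin d (T : measurableType d) (I : finType)
    (Q : I -> set T) :
  (forall i, measurable (Q i)) -> measurable [set w | forall i, Q i w].
Proof.
move=> mQ; rewrite (_ : [set w | _] = \bigcap_(i in setT) Q i).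
  by apply: fin_bigcap_measurable => //; exact: finite_finset.
by apply/seteqP; split=> w /= h i => [_|]; apply: h.
Qed.

Lemma measurable_exists_fin d (T : measurableType d) (I : finType)
    (Q : I -> set T) :
  (forall i, measurable (Q i)) -> measurable [set w | exists i, Q i w].
Proof.
move=> mQ; rewrite (_ : [set w | _] = \bigcup_(i in setT) Q i).
  by apply: fin_bigcup_measurable => //; exact: finite_finset.
by apply/seteqP; split=> w /= [i]; [exists i|move=> _ ?; exists i].
Qed.

Lemma measurable_bigmax d (T : measurableType d) (R : realType) (I : finType)
    (f : I -> T -> R) :
  (forall i, measurable_fun setT (f i)) ->
  measurable_fun setT (fun w => \big[Num.max/0]_i f i w).
Proof.
move=> mf; elim: (index_enum _) => [|i r IH].
  rewrite (_ : (fun w => _) = cst 0)//.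
  by apply/funext => w; rewrite big_nil.
rewrite (_ : (fun w => _) = (fun w => Num.max (f i w)
    (\big[Num.max/0]_(j <- r) f j w))); last first.
  by apply/funext => w; rewrite big_cons.
exact: measurable_maxr.
Qed.

Section copula_margins.
Context {R : realType} (d : nat).

Lemma measurable_joint_le (disp : measure_display) (T : measurableType disp)
    (P : probability T R) (X : 'I_d -> {RV P >-> R}) (u : 'rV[R]_d) :
  measurable [set w | forall i, X i w <= u 0 i].
Proof.
apply: measurable_forall_fin => i.
rewrite (_ : (fun w => _) = X i @^-1` `]-oo, u 0 i]).
  exact: measurable_funPTI.
by apply/seteqP; split=> w /=; rewrite in_itv.
Qed.

(** When no coordinate exceeds 1, a bound by 1 is no constraint, so a margin can
    be read off the joint distribution function. *)
Lemma cdf_joint_cdf (disp : measure_display) (T : measurableType disp)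
    (P : probability T R) (X : 'I_d -> {RV P >-> R}) i r :
  {ae P, forall w j, X j w <= 1} ->
  cdf (X i) r = joint_cdf X (\row_j (if j == i then r else 1)).
Proof.
move=> X1; rewrite /joint_cdf /cdf /distribution /pushforward; apply: measure_ae_eq.
- exact: measurable_funPTI.
- exact: measurable_joint_le.
- move: X1; apply: filterS => w X1 /=; rewrite in_itv/=; split.
    by move=> h j; rewrite mxE; case: eqP => [->|].
  by move=> /(_ i); rewrite mxE eqxx.
Qed.

(** The vector U and the vector witnessing that C is a copula live on different
    spaces and share only their joint distribution function.  Its value 1 at
    the vector of ones bounds both almost surely by 1, after which [cdf_joint_cdf] transfers the
    margins. *)
Lemma copula_margins (disp : measure_display) (T : measurableType disp)
    (P : probability T R) (U : 'I_d -> {RV P >-> R}) (C : 'rV[R]_d -> R) :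
  is_copula C -> (forall u, joint_cdf U u = (C u)%:E) ->
  forall i, uniform01 (U i).
Proof.
move=> [d' [T' [P' [U' [uU' hU']]]]] hU i A mA; rewrite -(uU' i A mA).
have ae' : {ae P', forall w j, U' j w <= 1}.
  by apply: ae_forall_fin => j; exact: uniform01_ae_le1.
have ae1 : {ae P, forall w j, U j w <= 1}.
  have eq1 (u : 'rV[R]_d) : joint_cdf U u = joint_cdf U' u by rewrite hU hU'.
  pose o : 'rV[R]_d := const_mx 1.
  exists (~` [set w | forall j, U j w <= o 0 j]).
  have mX := measurable_joint_le U o.
  split; first exact: measurableC.
    rewrite probability_setC//.
    rewrite [X in (_ - X)%E](eq1 o).
    rewrite [X in (_ - X)%E](_ : _ = P' setT).
      by rewrite probability_setT subee.
    apply: measure_ae_eq => //; first exact: measurable_joint_le.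
    by move: ae'; apply: filterS => w h; split => // _ j; rewrite mxE.
  by apply: subsetC => w /= h j; have := h j; rewrite mxE.
apply: cdf_inj_distribution => // r.
by rewrite !cdf_joint_cdf// hU hU'.
Qed.

End copula_margins.

(** * Homogeneity of box probabilities *)

Section boxes.
Context {R : realType} (d : nat) {disp : measure_display}
  {T : measurableType disp} {P : probability T R} (U : 'I_d -> {RV P >-> R}).
Implicit Types (x : 'rV[R]_d) (A B : seq 'I_d).

(** In terms of V = 1 - U the constraints are V_i <= x_i and V_i > x_i.  Lists
    suit the recursion [pbox_split]; only their elements matter. *)
Definition box x A B : set T :=
  [set w | forall i, (i \in A -> 1 - x 0 i <= U i w) /\
                     (i \in B -> U i w < 1 - x 0 i)].

Definition pbox x A B : R := fine (P (box x A B)).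

Lemma measurable_box x A B : measurable (box x A B).
Proof.
apply: measurable_forall_fin => i.
have mge : measurable [set w | 1 - x 0 i <= U i w].
  rewrite (_ : [set w | _] = U i @^-1` `[1 - x 0 i, +oo[).
    exact: measurable_funPTI.
  by apply/seteqP; split=> w /=; rewrite in_itv/= andbT.
have mlt : measurable [set w | U i w < 1 - x 0 i].
  rewrite (_ : [set w | _] = U i @^-1` `]-oo, 1 - x 0 i[).
    exact: measurable_funPTI.
  by apply/seteqP; split=> w /=; rewrite in_itv.
rewrite (_ : (fun w => _) =
    (if i \in A then [set w | 1 - x 0 i <= U i w] else setT) `&`
    (if i \in B then [set w | U i w < 1 - x 0 i] else setT)).
  by apply: measurableI; case: ifP.
apply/seteqP; split=> w /= [h1 h2]; split.
- by move: h1; case: ifP => // _; apply.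
- by move: h2; case: ifP => // _; apply.
- by move=> iA; move: h1; rewrite iA.
- by move=> iB; move: h2; rewrite iB.
Qed.

Lemma pboxE x A B : P (box x A B) = (pbox x A B)%:E.
Proof. by rewrite fineK// fin_num_measure//; exact: measurable_box. Qed.

Lemma eq_pbox x x' A A' B B' : A =i A' -> B =i B' ->
  (forall i, (i \in A) || (i \in B) -> x 0 i = x' 0 i) ->
  pbox x A B = pbox x' A' B'.
Proof.
move=> AA' BB' xx'; congr (fine (P _)); apply/seteqP; split=> w /= h i.
  by rewrite -AA' -BB'; split=> hi; rewrite -xx' ?hi ?orbT//; apply h.
by split=> hi; rewrite xx' ?hi ?orbT//; apply h; rewrite -?AA' -?BB'.
Qed.

Lemma pbox_nil x : pbox x [::] [::] = 1.
Proof.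
rewrite /pbox (_ : box _ _ _ = setT) ?probability_setT//.
by apply/seteqP; split=> w // _ i; split.
Qed.

(** This recursion trades a constraint of one kind for a constraint of the other
    kind, and replaces an inclusion-exclusion formula in both directions of
    the characterization. *)
Lemma pbox_split x A B a : pbox x A B = pbox x (a :: A) B + pbox x A (a :: B).
Proof.
apply: EFin_inj; rewrite EFinD -!pboxE -measureU.
- congr (P _); apply/seteqP; split=> w /=.
    move=> h; case: (leP (1 - x 0 a) (U a w)) => hw; [left|right] => i;
    have [h1 h2] := h i; split => //; rewrite inE => /orP[/eqP->//|]; auto.
  by case=> h i; have [h1 h2] := h i; split=> hi;
    [apply: h1|apply: h2|apply: h1|apply: h2]; rewrite ?inE ?hi ?orbT.
- exact: measurable_box.
- exact: measurable_box.
- apply/seteqP; split=> w //= [/(_ a)[+ _] /(_ a)[_]].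
  by rewrite !inE eqxx => /(_ isT) h1 /(_ isT); rewrite ltNge h1.
Qed.

Section homogeneity.
Variables (x : 'rV[R]_d) (t : R).

(** The defect pbox (t x) A B - t pbox x A B is 1 - t when A is empty, whatever B
    is; [pbox_split] expresses the defect for (a :: A, B) as the difference
    of two defects with the shorter list A, so it vanishes. *)
Lemma box_homogeneous_ge :
  (forall B, pbox (t *: x) [::] B = 1 - t + t * pbox x [::] B) ->
  forall a A B, pbox (t *: x) (a :: A) B = t * pbox x (a :: A) B.
Proof.
move=> h a A; elim: A a => [|b A IH] a B.
  have := pbox_split (t *: x) [::] B a; have := pbox_split x [::] B a.
  rewrite !h => ->; lra.
have := pbox_split (t *: x) (b :: A) B a.
have := pbox_split x (b :: A) B a.
rewrite !IH => ->; lra.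
Qed.

(** The same recursion, read in the other direction: the defect vanishes for A
    nonempty, by induction on B, and hence equals that of the empty box,
    1 - t, when A is empty. *)
Lemma box_homogeneous_lt :
  (forall a A, pbox (t *: x) (a :: A) [::] = t * pbox x (a :: A) [::]) ->
  forall B, pbox (t *: x) [::] B = 1 - t + t * pbox x [::] B.
Proof.
move=> h.
have h' B a A : pbox (t *: x) (a :: A) B = t * pbox x (a :: A) B.
  elim: B a A => [|b B IH] a A //.
  have := pbox_split (t *: x) (a :: A) B b.
  have := pbox_split x (a :: A) B b.
  rewrite !IH => ->; lra.
elim=> [|b B IH]; first by rewrite !pbox_nil; lra.
have := pbox_split (t *: x) [::] B b.
have := pbox_split x [::] B b.
rewrite IH h' => ->; lra.
Qed.

End homogeneity.

Lemma exceedance_box (S : {set 'I_d}) x (u : 'I_#|S| -> R) :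
  (forall j, u j = x 0 (enum_val j)) ->
  [set w | forall j, 1 - u j <= subvector U S j w] = box x (enum S) [::].
Proof.
move=> ux; apply/seteqP; split=> w /= h.
  move=> i; split=> //; rewrite mem_enum => iS.
  by have := h (enum_rank_in iS i); rewrite ux /subvector enum_rankK_in.
by move=> j; rewrite ux; apply h; rewrite mem_enum enum_valP.
Qed.

End boxes.

Section gpc_exceedance.
Context {R : realType} (d : nat) {disp : measure_display}
  {T : measurableType disp} {P : probability T R} (U : 'I_d -> {RV P >-> R}).
Hypothesis uU : forall i, uniform01 (U i).

(** The margins have no atoms and are at most 1, so strict inequalities can be
    relaxed and the coordinates outside B left free. *)
Lemma pbox_joint_cdf (x : 'rV[R]_d) (B : seq 'I_d) :
  (pbox U x [::] B)%:E =
  joint_cdf U (const_mx 1 - \row_j (if j \in B then x 0 j else 0)).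
Proof.
rewrite -pboxE; apply: measure_ae_eq.
- exact: measurable_box.
- exact: measurable_joint_le.
- have h1 : {ae P, forall w j, U j w <= 1}.
    by apply: ae_forall_fin => j; exact: uniform01_ae_le1.
  have h2 : {ae P, forall w j, U j w != 1 - x 0 j}.
    by apply: ae_forall_fin => j; exact: uniform01_neq.
  apply: filterS2 h1 h2 => w h1 h2 /=; split=> [h i|h i].
    by rewrite !mxE; case: ifP => iB; [apply/ltW; apply h|rewrite subr0].
  split=> // iB; have := h i; rewrite !mxE iB.
  by rewrite le_eqVlt (negbTE (h2 i)).
Qed.

(** Near 0 the strict boxes have probability 1 - N(x_B), whose dependence on a
    scaling of x is that required by [box_homogeneous_ge]; the event of
    exceedance stability for S is the box with A an enumeration of S. *)
Lemma gpc_exceedance_stable (C : 'rV[R]_d -> R) :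
  (forall u, joint_cdf U u = (C u)%:E) -> is_GPC C ->
  forall S : {set 'I_d}, S != finset.set0 -> exceedance_stable (subvector U S).
Proof.
move=> hU [_ [N [u0 [[[_ _ Nhom _] _] u01 CN]]]] S /set0Pn[a aS].
have [e e0 eu] : exists2 e, 0 < e & forall i, e <= 1 - u0 0 i.
  have : \forall e \near 0^'+, forall i, e <= 1 - u0 0 i.
    apply: filter_forall => i; apply: nbhs_right_le.
    by have /andP[] := u01 i; lra.
  move=> h; near (0 : R)^'+ => e; exists e; near: e; last exact: h.
  exact: nbhs_right_gt.
exists e => // t u /andP[t0 t1] hu.
pose x : 'rV[R]_d := \row_i (if i \in S then u 0 (enum_rank_in aS i) else 0).
have xe i : 0 <= x 0 i <= e.
  by rewrite mxE; case: ifP => _; [exact: hu|rewrite lexx ltW].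
have xu j : u 0 j = x 0 (enum_val j).
  by rewrite mxE enum_valP enum_valK_in.
have pN (y : 'rV[R]_d) (B : seq 'I_d) : (forall i, 0 <= y 0 i <= e) ->
    pbox U y [::] B = 1 - N (\row_j (if j \in B then y 0 j else 0)).
  move=> ye; apply: EFin_inj; rewrite pbox_joint_cdf hU CN.
    by rewrite opprB addrCA subrr addr0.
  move=> i; rewrite !mxE; have := ye i; have := eu i; have := u01 i.
  by case: ifP => _ /andP[? ?] ? /andP[? ?]; apply/andP; split; lra.
rewrite (@exceedance_box _ _ _ _ _ U S (t *: x)); last by move=> j; rewrite mxE xu.
rewrite (@exceedance_box _ _ _ _ _ U S (x))// !pboxE -EFinM; congr EFin.
have : a \in enum S by rewrite mem_enum.
case: (enum S) => // b A _; apply: box_homogeneous_ge => B.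
rewrite !pN//; last first.
  move=> i; rewrite mxE; have /andP[x0 xe'] := xe i.
  by rewrite mulr_ge0//= (le_trans _ xe')// ler_piMl.
rewrite (_ : \row_j _ = t *: \row_j (if j \in B then x 0 j else 0)).
  by rewrite Nhom ger0_norm//; lra.
by apply/rowP => j; rewrite !mxE; case: ifP => //; rewrite mulr0.
Unshelve. all: by end_near. Qed.

(** There are finitely many subsets, so a common radius serves all of them. *)
Lemma exceedance_stable_pbox :
  (forall S : {set 'I_d}, S != finset.set0 ->
    exceedance_stable (subvector U S)) ->
  exists e : R, [/\ 0 < e, e < 1 &
    forall t (x : 'rV[R]_d), 0 <= t <= 1 -> (forall i, 0 <= x 0 i <= e) ->
    forall a A, pbox U (t *: x) (a :: A) [::] = t * pbox U x (a :: A) [::]].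
Proof.
move=> hS.
pose Q (S : {set 'I_d}) (e : R) := S != finset.set0 ->
  forall t (u : 'rV[R]_#|S|), 0 <= t <= 1 -> (forall i, 0 <= u 0 i <= e) ->
      P [set w | forall i, 1 - t * u 0 i <= subvector U S i w] =
      (t%:E * P [set w | forall i, (1 - u 0 i <= subvector U S i w)%R])%E.
have QS : \forall e \near 0^'+, forall S, Q S e.
  apply: filter_forall => S; have [->|S0] := eqVneq S finset.set0.
    by near=> e; rewrite /Q eqxx.
  have [e0 e00 he0] := hS S S0.
  near=> e => _ t u t01 hu; apply: he0 => // i.
  have /andP[-> h] := hu i; rewrite (le_trans h)//.
  by near: e; exact: nbhs_right_le.
near (0 : R)^'+ => e; exists e; split.
- by near: e; exact: nbhs_right_gt.
- by near: e; exact: nbhs_right_lt.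
move=> t x t01 xe a A.
pose S := [set i in a :: A]%SET.
have aS : a \in S by rewrite !inE eqxx.
have S0 : S != finset.set0 by apply/set0Pn; exists a.
pose u : 'rV[R]_#|S| := \row_j x 0 (enum_val j).
have /(_ S S0 t u t01) : forall S, Q S e by near: e; exact: QS.
rewrite (@exceedance_box _ _ _ _ _ U S (t *: x) (fun j => t * u 0 j));
  last by move=> j; rewrite !mxE.
rewrite (@exceedance_box _ _ _ _ _ U S x (u 0)); last by move=> j; rewrite !mxE.
rewrite !pboxE -EFinM => h.
have enumS : a :: A =i enum S by move=> i; rewrite mem_enum !inE.
rewrite (eq_pbox U enumS (B' := [::]) (x' := t *: x))//.
rewrite (eq_pbox U enumS (B' := [::]) (x' := x))//.
by apply: EFin_inj; apply: h => i; rewrite mxE.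
Unshelve. all: by end_near. Qed.

End gpc_exceedance.

(** * Vectors and their truncated dilations *)

Section vector_space.
Context {R : realType} (d : nat).
Local Notation vec := ('I_d -> R).

(** Orthants constrain only the coordinates in A: the probabilities of such
    events are what exceedance stability controls, and they form a
    pi-system. *)
Definition orthants : set (set vec) :=
  [set B | exists (A : {set 'I_d}) (c : vec),
     B = [set y | forall i, i \in A -> c i <= y i]].

Definition vspace := g_sigma_algebraType orthants.

Lemma orthantsI : setI_closed orthants.
Proof.
move=> _ _ [A [c ->]] [A' [c' ->]].
exists (A :|: A')%SET, (fun i => if i \in A then
  (if i \in A' then Num.max (c i) (c' i) else c i) else c' i).
apply/seteqP; split=> y /=.
  move=> [h h'] i; rewrite inE.
  have {}h := h i; have {}h' := h' i.
  case: (i \in A) h => h; case: (i \in A') h' => h' //= _; auto.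
  by rewrite ge_max h// h'.
move=> h; split=> i iA; have := h i; rewrite inE iA ?orbT => /(_ isT);
by case: ifP => // _; rewrite ge_max => /andP[].
Qed.

Lemma measurable_coord i : measurable_fun setT (fun y : vspace => y i).
Proof.
apply: (measurability (@measurable_realfun.RGenCInfty.G R)).
  exact: measurable_realfun.RGenCInfty.measurableE.
move=> _ [_ [r ->] <-]; rewrite setTI; apply: sub_sigma_algebra.
exists [set i]%SET, (fun=> r); apply/seteqP; split=> y /=; rewrite in_itv/= andbT.
  by move=> h j; rewrite inE => /eqP ->.
by apply; rewrite inE.
Qed.

Lemma measurable_vector disp (X : measurableType disp) (f : X -> vspace) :
  (forall i, measurable_fun setT (fun x => f x i)) -> measurable_fun setT f.
Proof.
move=> mf; apply: (@measurability _ _ X vspace setT f orthants) => //.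
move=> _ [_ [A [c ->]] <-]; rewrite setTI.
rewrite (_ : _ @^-1` _ = [set x | forall i, i \in A -> c i <= f x i])//.
apply: measurable_forall_fin => i.
case: (boolP (i \in A)) => iA; last first.
  by rewrite (_ : (fun=> _) = setT)//; apply/seteqP; split.
rewrite (_ : (fun x => _) = (fun x => f x i) @^-1` `[c i, +oo[).
  by rewrite -[X in measurable X]setTI; apply: mf.
by apply/seteqP; split=> x /=; rewrite in_itv/= andbT//; apply.
Qed.

Definition vscale (a : R) (y : vspace) : vspace := fun i => a * y i.

Lemma measurable_vscale a : measurable_fun setT (vscale a).
Proof.
apply: measurable_vector => i; apply: measurable_funM => //.
exact: measurable_coord.
Qed.

HB.instance Definition _ a :=
  isMeasurableFun.Build _ _ _ _ (vscale a) (measurable_vscale a).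

Lemma vscaleA a b y : vscale a (vscale b y) = vscale (a * b) y.
Proof. by apply/funext => i; rewrite /vscale mulrA. Qed.

Lemma measurable_coord_ge i r : measurable [set y : vspace | r <= y i].
Proof.
rewrite (_ : [set y : vspace | _] = (fun y : vspace => y i) @^-1` `[r, +oo[).
  by rewrite -[X in measurable X]setTI; exact: measurable_coord.
by apply/seteqP; split=> x /=; rewrite in_itv/= andbT.
Qed.

Lemma measurable_coord_neq0 i : measurable [set y : vspace | y i != 0].
Proof.
rewrite (_ : [set y : vspace | _] = (fun y : vspace => y i) @^-1` ~` [set 0]).
  by rewrite -[X in measurable X]setTI; apply: measurable_coord => //; exact: measurableC.
by apply/seteqP; split=> x /= /eqP.
Qed.

(** The exponent measure is finite on this complement of a neighbourhood of 0
    in the nonnegative vectors. *)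
Definition far (h : R) : set vspace := [set y | exists i, h <= y i].

Lemma measurable_far h : measurable (far h).
Proof.
apply: measurable_exists_fin => i; exact: measurable_coord_ge.
Qed.

(** A vector whose coordinates below h have been replaced by 0 keeps this form
    when it is halved and its coordinates that fall below h are erased. *)
Definition halve (h : R) (y : vspace) : vspace :=
  fun i => if 2 * h <= y i then y i / 2 else 0.

Lemma measurable_halve h : measurable_fun setT (halve h).
Proof.
apply: measurable_vector => i; rewrite /halve.
apply: measurable_fun_if => //.
- by apply: measurable_fun_ler => //; exact: measurable_coord.
- apply: measurable_funTS; apply: measurable_funM => //; exact: measurable_coord.
Qed.

HB.instance Definition _ h :=
  isMeasurableFun.Build _ _ _ _ (halve h) (measurable_halve h).

End vector_space.
Arguments vscale {R d}.
Arguments halve {R d}.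
Arguments far {R d}.

(** * The exponent measure *)

Section exponent_measure.
Context {R : realType} (d : nat).
Local Notation V := (@vspace R d).
(* In the application, mu0 is the law of a nonnegative vector whose coordinates
   below h have been replaced by 0. *)
Variables (mu0 : probability V R) (h : R).
Implicit Types A B : set V.
Hypothesis h0 : 0 < h.
Hypothesis mu0_halve : forall B : set V, measurable B -> ~ B (fun=> 0) ->
  mu0 (halve h @^-1` B) = (2^-1%:E * mu0 B)%E.

Let m (B : set V) := fine (mu0 B).

Let mE B : measurable B -> mu0 B = (m B)%:E.
Proof. by move=> mB; rewrite fineK// fin_num_measure. Qed.

Let m_halve B : measurable B -> ~ B (fun=> 0) -> m (halve h @^-1` B) = 2^-1 * m B.
Proof.
move=> mB B0; apply: EFin_inj; rewrite EFinM -!mE//; first exact: mu0_halve.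
exact: measurable_funPTI.
Qed.

Let le_m A B : measurable A -> measurable B -> A `<=` B -> m A <= m B.
Proof.
by move=> mA mB AB; rewrite -lee_fin -!mE// le_measure// inE.
Qed.

Let mU A B : measurable A -> measurable B -> m (A `|` B) <= m A + m B.
Proof.
move=> mA mB; rewrite -lee_fin EFinD -!mE//; last exact: measurableU.
exact: measureU2.
Qed.

Let m_diff A B : measurable A -> measurable B -> B `<=` A ->
  m (A `\` B) = m A - m B.
Proof.
move=> mA mB BA; apply: EFin_inj; rewrite EFinB -!mE//; last exact: measurableD.
by rewrite measureD// ?setIidr// ltey_eq fin_num_measure.
Qed.

Let m_bigcup (A : 'I_d -> set V) : (forall i, measurable (A i)) ->
  m [set y | exists i, A i y] <= \sum_i m (A i).
Proof.
move=> mA; rewrite -lee_fin.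
have -> : (\sum_i m (A i))%:E = (\sum_i mu0 (A i))%E.
  by rewrite -sumEFin; apply: eq_bigr => i _; rewrite mE.
rewrite (_ : [set y | _] = \big[setU/set0]_(i < d) A i); last first.
  apply/seteqP; split=> y /=.
    by move=> [i Ay]; rewrite (bigD1 i)//=; left.
  elim/big_ind: _ => // [S1 S2 h1 h2 [/h1|/h2]//|i _ Ay]; by exists i.
rewrite -mE; last by apply: bigsetU_measurable.
pose K S x := measurable S /\ (mu0 S <= x)%E.
suff [] : K (\big[setU/set0]_(i < d) A i) (\sum_i mu0 (A i))%E by [].
apply: big_ind2 => [|S1 x1 S2 x2 [mS1 h1] [mS2 h2]|i _]; split => //.
- by rewrite measure0.
- exact: measurableU.
- by rewrite (le_trans (measureU2 _ mS1 mS2))// leeD.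
Qed.

Let rho n : R := 2^-1 ^+ n.

(* The approximations of the exponent measure. *)
Let lam n (B : set V) : R := 2 ^+ n * m (vscale (rho n) @^-1` (B `&` far h)).

Let rhoS n i (y : V) : vscale (rho n.+1) y i = vscale (rho n) y i / 2.
Proof. by rewrite /vscale /rho exprS; lra. Qed.

Let rho_gt0 n : 0 < rho n. Proof. by rewrite exprn_gt0// invr_gt0. Qed.

Let rho_le1 n : rho n <= 1.
Proof. by rewrite exprn_ile1// invf_le1// ler1n. Qed.

Let far_ge n i (y : V) : h <= vscale (rho n.+1) y i -> 2 * h <= y i.
Proof.
rewrite rhoS /vscale => hy.
have r0 := rho_gt0 n; have r1 := rho_le1 n.
have y0 : 0 < y i.
  by rewrite -(pmulr_rgt0 _ r0); have := h0; lra.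
have : rho n * y i <= y i by rewrite ler_piMl// ltW.
lra.
Qed.

Let mpre n B : measurable B -> measurable (vscale (rho n) @^-1` (B `&` far h)).
Proof.
move=> mB; apply: measurable_funPTI; apply: measurableI => //.
exact: measurable_far.
Qed.

Let not_far0 n B : ~ (vscale (rho n) @^-1` (B `&` far h)) (fun=> 0).
Proof. by case=> _ [i]; rewrite /vscale mulr0 leNgt h0. Qed.

Let lam_halve n B : measurable B ->
  lam n B = 2 ^+ n.+1 * m (halve h @^-1` (vscale (rho n) @^-1` (B `&` far h))).
Proof.
move=> mB; rewrite (m_halve (mpre n mB) (@not_far0 n B)).
by rewrite /lam exprS; field.
Qed.

Let halve_far n (y : V) : far h (vscale (rho n) (halve h y)) <->
  far h (vscale (rho n.+1) y).
Proof.
split=> -[i]; rewrite /halve.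
  rewrite {1}/vscale; case: ifP => hy; last by rewrite mulr0 leNgt h0.
  by move=> hi; exists i; rewrite rhoS /vscale; lra.
move=> hi; exists i; rewrite {1}/vscale (far_ge hi).
by move: hi; rewrite rhoS /vscale; lra.
Qed.

(* Halving and then scaling by 2^-n agrees with scaling by 2^-(n+1), except at
   the vectors with a nonzero coordinate that halving erases.  By the halving
   hypothesis the former gives another expression of lam n, so that lost n
   accounts for the difference between lam n and lam n.+1. *)
Let lost n i : set V :=
  [set y | y i != 0] `&` (vscale (rho n.+1) @^-1` (setT `&` far h)) `\`
  (halve h @^-1` (vscale (rho n) @^-1` ([set y | y i != 0] `&` far h))).

(* This sequence controls the total variation: its increments are the masses
   lost, and it is bounded because the total mass of lam n is constant. *)
Let c n := \sum_i lam n [set y : V | y i != 0].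

Let vscale_neq0 n i (y : V) : (vscale (rho n) y i != 0) = (y i != 0).
Proof. by rewrite mulf_eq0 gt_eqF. Qed.

Let lost_sum n : 2 ^+ n.+1 * \sum_i m (lost n i) = c n.+1 - c n.
Proof.
rewrite /c -sumrB mulr_sumr; apply: eq_bigr => i _.
rewrite (@lam_halve n); last exact: measurable_coord_neq0.
rewrite /lam -mulrBr; congr (_ * _); rewrite /lost m_diff.
- congr (m _ - _); apply/seteqP; split=> y /=.
    by move=> [y0 [_ yf]]; rewrite vscale_neq0.
  by rewrite vscale_neq0 => -[].
- apply: measurableI; first exact: measurable_coord_neq0.
  by apply: mpre.
- apply: measurable_funPTI; apply: mpre; exact: measurable_coord_neq0.
- move=> y /= [+ /halve_far yf]; rewrite vscale_neq0 => hy; split => //.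
  move: hy; rewrite /halve; case: ifP => _; rewrite ?eqxx//.
  by rewrite mulf_eq0 negb_or => /andP[].
Qed.

Let mlost n i : measurable (lost n i).
Proof.
apply: measurableD.
  by apply: measurableI; [exact: measurable_coord_neq0|exact: mpre].
apply: measurable_funPTI; apply: mpre; exact: measurable_coord_neq0.
Qed.

Let same n (y : V) : far h (vscale (rho n.+1) y) -> (forall i, ~ lost n i y) ->
  vscale (rho n) (halve h y) = vscale (rho n.+1) y.
Proof.
move=> yf hl; apply/funext => i; rewrite rhoS /vscale /halve.
case: ifP => hy; first by rewrite mulrA.
have [->|y0] := eqVneq (y i) 0; first by rewrite mulr0 mul0r.
exfalso; apply: (hl i); split => //.
by case; rewrite /= vscale_neq0 /halve hy eqxx.
Qed.

Let lam_step n B : measurable B -> `|lam n.+1 B - lam n B| <= c n.+1 - c n.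
Proof.
move=> mB; rewrite (@lam_halve n)// /lam -mulrBr normrM ger0_norm ?exprn_ge0//.
rewrite -lost_sum ler_pM2l ?exprn_gt0//.
have mL : measurable [set y | exists i, lost n i y].
  by apply: measurable_exists_fin => i; exact: mlost.
have m1 := mpre n.+1 mB.
have m2 : measurable (halve h @^-1` (vscale (rho n) @^-1` (B `&` far h))).
  by apply: measurable_funPTI; exact: mpre.
have key A A' : measurable A -> measurable A' ->
    A `<=` A' `|` [set y | exists i, lost n i y] ->
    m A - m A' <= \sum_i m (lost n i).
  move=> mA mA' AA'; rewrite lerBlDl.
  apply: (le_trans (le_m mA (measurableU _ _ mA' mL) AA')).
  apply: (le_trans (mU mA' mL)); rewrite lerD2l.
  by apply: m_bigcup => i; exact: mlost.
apply/ler_normlP; rewrite opprB; split; apply: key => // y [By yf];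
  (case: (pselect (exists i, lost n i y)) => [|hl]; [by right|left]).
  have /halve_far yf' := yf.
  by split; rewrite -same// => i li; apply: hl; exists i.
by split; rewrite same// => i li; apply: hl; exists i.
Qed.

Let lamT n : lam n setT = lam 0 setT.
Proof.
elim: n => // n <-; rewrite (@lam_halve n)// {1}/lam; congr (_ * m _).
by apply/seteqP; split=> y /= [_ /halve_far].
Qed.

Let c_bound n : c n <= lam 0 setT *+ d.
Proof.
rewrite /c -[X in _ *+ X]card_ord -sumr_const; apply: ler_sum => i _.
rewrite -(lamT n) /lam ler_pM2l ?exprn_gt0//; apply: le_m.
- apply: mpre; exact: measurable_coord_neq0.
- exact: mpre.
- by move=> y /= [].
Qed.

Let mulam n : {measure set V -> \bar R} :=
  mscale (NngNum (exprn_ge0 n (ler0n R 2)))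
   (mrestr (distribution mu0 (vscale (rho n))) (measurable_far h)).

Let mulamE n B : measurable B -> mulam n B = (lam n B)%:E.
Proof.
move=> mB.
transitivity ((2 ^+ n)%:E * mu0 (vscale (rho n) @^-1` (B `&` far h)))%E => //.
by rewrite mE// -?EFinM//; exact: mpre.
Qed.

(** The scaling property passes to the limit because scaling by 1/2 maps each
    approximation to half of the next one.  The second property evaluates the
    limit on the sets whose mu0-measure is exactly homogeneous. *)
Lemma exponent_measure : exists L : {finite_measure set V -> \bar R},
  (forall B, measurable B -> B `<=` far h ->
     L (vscale 2^-1 @^-1` B) = (2^-1%:E * L B)%E) /\
  (forall B v, measurable B -> B `<=` far h ->
     (forall n, mu0 (vscale (2^-1 ^+ n) @^-1` B) = (2^-1 ^+ n * v)%:E) ->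
     L B = v%:E).
Proof.
have [|||L hL] := @finite_measure_limit _ _ _ mulam c (lam 0 setT *+ d).
- by move=> n B mB; rewrite mulamE.
- by move=> n B mB; rewrite !mulamE//=; exact: lam_step.
- exact: c_bound.
have hL' B : measurable B -> (lam n B)%:E @[n --> \oo] --> L B.
  move=> mB; have := hL B mB.
  rewrite (_ : (fun n => mulam n B) = (fun n => (lam n B)%:E))//.
  by apply/funext => n; rewrite mulamE.
exists L; split.
- move=> B mB Bf.
  have mB2 : measurable (vscale 2^-1 @^-1` B) by exact: measurable_funPTI.
  have h1 := hL' _ mB2; have h2 := hL' _ mB.
  rewrite -(cvg_lim _ h1)//; apply/cvg_lim => //.
  rewrite (_ : (fun n => _) = (fun n => 2^-1%:E * (lam n.+1 B)%:E)%E).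
    apply: cvgeZl => //.
    by rewrite (cvg_shiftS (fun n => (lam n B)%:E)).
  apply/funext => n; rewrite -EFinM /lam; congr EFin.
  rewrite exprS -!mulrA mulKf//; congr (_ * m _).
  have E (y : V) : vscale 2^-1 (vscale (rho n) y) = vscale (rho n.+1) y.
    by rewrite vscaleA -exprS.
  apply/seteqP; split=> y /= []; rewrite E => By yf; split => //.
    exact: Bf.
  case: yf => i hi; exists i; have hi' := far_ge hi; move: hi; rewrite rhoS.
  by have := rho_gt0 n; have := h0; rewrite /vscale; nra.
- move=> B v mB Bf hv; have h1 := hL' _ mB.
  rewrite -(cvg_lim _ h1)//; apply/cvg_lim => //.
  rewrite (_ : (fun n => _) = cst v%:E); first exact: cvg_cst.
  apply/funext => n; rewrite /lam /=; congr EFin.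
  rewrite setIidl// /m hv/= mulrA -exprMn divff// ?expr1n ?mul1r//.
Qed.

End exponent_measure.

(** * Averaging level sets over one octave *)

Section layer_cake.
Context {disp : measure_display} {T : measurableType disp} {R : realType}.
Variable L : {finite_measure set T -> \bar R}.
Variables (D : set T) (G : T -> R).
Hypotheses (mD : measurable D) (mG : measurable_fun setT G).

Local Notation leb := (@lebesgue_measure R).

(** The length of the set of s in [1, 2] with s <= u. *)
Definition ramp (u : R) : R := Num.min u 2 - Num.min u 1.

Lemma measurable_ge_level s : measurable [set y | s <= G y].
Proof.
rewrite (_ : [set y | _] = G @^-1` `[s, +oo[).
  by rewrite -[X in measurable X]setTI; apply: mG.
by apply/seteqP; split=> x /=; rewrite in_itv/= andbT.
Qed.

Let measurable_subgraph (I : set R) : measurable I ->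
  measurable ((D `*` I) `&` [set p : T * R | p.2 <= G p.1]).
Proof.
move=> mI; apply: measurableI; first exact: measurableX.
rewrite (_ : [set p | _] = (fun p : T * R => G p.1 - p.2) @^-1` `[0, +oo[).
  rewrite -[X in measurable X]setTI; apply: measurable_funB => //.
  exact: measurableT_comp.
by apply/seteqP; split=> p /=; rewrite in_itv/= andbT subr_ge0.
Qed.

Lemma measurable_levels :
  measurable_fun setT (fun s : R => L (D `&` [set y | s <= G y])).
Proof.
have := measurable_fun_ysection L (measurable_subgraph measurableT).
congr (measurable_fun _ _); apply/funext => s /=; congr (L _).
apply/seteqP; split=> y /=; rewrite /ysection/= inE/=.
  by move=> [[? _] ?].
by move=> [? ?].
Qed.

(** Tonelli's theorem for the part of the subgraph of G between the heights 1
    and 2. *)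
Lemma integral_levels :
  (\int[leb]_(s in `[1%R, 2%R]) L (D `&` [set y | (s <= G y)%R]) =
   \int[L]_(y in D) (ramp (G y))%:E)%E.
Proof.
pose A : set (T * R) := (D `*` `[1, 2]) `&` [set p | p.2 <= G p.1].
have mA : measurable A by exact: measurable_subgraph.
have FG : (\int[L]_x (leb \o xsection A) x =
           \int[leb]_y (L \o ysection A) y)%E.
  rewrite -(indic_fubini_tonelli_FE leb mA) -(indic_fubini_tonelli_GE L mA).
  exact: indic_fubini_tonelli.
rewrite [LHS]integral_mkcond [RHS]integral_mkcond.
transitivity (\int[leb]_s (L \o ysection A) s)%E.
  apply: eq_integral => s _ /=; rewrite patchE; case: ifPn => sI.
    congr (L _); apply/seteqP; split=> y /=; rewrite /ysection/= inE /A/=.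
      by move=> [? ?]; split => //; split => //; move: sI; rewrite inE.
    by move=> [[? ?] ?].
  rewrite (_ : ysection A s = set0) ?measure0//.
  apply/seteqP; split=> y //=; rewrite /ysection/= inE /A/= => -[[_ h] _].
  by move: sI; rewrite notin_setE.
rewrite -FG; apply: eq_integral => y _ /=; rewrite patchE; case: ifPn => yD.
  rewrite (_ : xsection A y = `[1, Num.min (G y) 2]%classic).
    rewrite lebesgue_measure_itv/= lte_fin /ramp.
    case: ltP => [h|].
      by rewrite -EFinB; congr (_%:E); move: h;
        case: (leP (G y) 2); case: (leP (G y) 1); lra.
    by move=> h; congr (_%:E); move: h; case: (leP (G y) 2); case: (leP (G y) 1); lra.
  apply/seteqP; split=> s /=; rewrite /xsection/= inE /A/= !in_itv/=.
    by move=> [[_ /andP[-> h]] h']; rewrite le_min h' h.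
  rewrite le_min => /and3P[-> -> ->]; split => //; split => //.
  by move: yD; rewrite inE.
rewrite (_ : xsection A y = set0) ?measure0//.
apply/seteqP; split=> s //=; rewrite /xsection/= inE /A/= => -[[h _] _].
by move: yD; rewrite notin_setE.
Qed.

End layer_cake.

(** The term of index j is the length of the part of [0, r] between 2^-j and
    2^(1-j), so the series telescopes; this is how the dyadic shells reassemble
    a linear function from the truncated one. *)
Lemma ramp_dyadic {R : realType} (r : R) : 0 <= r < 2 ->
  (\sum_(0 <= j <oo) ((2^-1 ^+ j * ramp (2 ^+ j * r))%R)%:E = r%:E)%E.
Proof.
move=> /andP[r0 r2]; apply/cvg_lim => //.
have E j : 2^-1 ^+ j * ramp (2 ^+ j * r) =
    Num.min r (2 * 2^-1 ^+ j) - Num.min r (2^-1 ^+ j) :> R.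
  have p0 : (0 : R) < 2^-1 ^+ j by rewrite exprn_gt0// invr_gt0.
  rewrite /ramp mulrBr !minr_pMr ?ltW//.
  by rewrite mulrA -exprMn mulVf// expr1n mul1r mulr1 (mulrC _ 2).
have S n : \sum_(0 <= j < n) 2^-1 ^+ j * ramp (2 ^+ j * r) =
    r - Num.min r (2 * 2^-1 ^+ n) :> R.
  elim: n => [|n IH].
    by rewrite big_geq// expr0 mulr1 min_l ?subrr// ltW.
  rewrite big_nat_recr//= IH E exprS mulrA divff// mul1r; lra.
rewrite (_ : (fun n => _) = EFin \o (fun n => r - Num.min r (2 * 2^-1 ^+ n))).
  apply: cvg_EFin; first exact: nearW.
  rewrite (_ : fine \o _ = (fun n => r - Num.min r (2 * 2^-1 ^+ n)))//.
  rewrite -[X in _ --> X]subr0; apply: cvgB; first exact: cvg_cst.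
  apply: (@squeeze_cvgr _ _ _ _ (cst 0) (fun n => 2 * 2^-1 ^+ n)).
  - apply: nearW => n; rewrite le_min r0/= mulr_ge0 ?exprn_ge0 ?invr_ge0//=.
    by rewrite ge_min lexx orbT.
  - exact: cvg_cst.
  - rewrite -[X in _ --> X](mulr0 2); apply: cvgM; first exact: cvg_cst.
    by apply: cvg_expr; rewrite ger0_norm ?invr_ge0// invf_lt1// ltr1n.
by apply/funext => n /=; rewrite sumEFin S.
Qed.

(** * The spectral integral *)

Section harmonic_constant.
Context {R : realType}.
Local Notation leb := (@lebesgue_measure R).

(** The value is ln 2. *)
Definition harmonic12 : R := fine (\int[leb]_(s in `[1%R, 2%R]) (s^-1)%:E)%E.

Lemma measurable_inv12 :
  measurable_fun (`[1, 2]%classic : set R) (fun s : R => (s^-1)%:E).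
Proof.
apply: measurableT_comp => //.
apply: subspace_continuous_measurable_fun => //.
apply: continuous_in_subspaceT => s; rewrite inE/= in_itv/= => /andP[s1 _].
by apply: inv_continuous; rewrite gt_eqF// (lt_le_trans _ s1).
Qed.

Let leb12 : leb `[1, 2] = 1%E.
Proof.
rewrite lebesgue_measure_itv/= lte_fin ltr1n -EFinB; congr EFin; lra.
Qed.

Let harmonic12_ub : (\int[leb]_(s in `[1%R, 2%R]) (s^-1)%:E <= 1)%E.
Proof.
rewrite -leb12 -[leRHS]mul1e -integral_cst//.
apply: ge0_le_integral => //.
- move=> s /=; rewrite in_itv/= => /andP[s1 _].
  by rewrite lee_fin invr_ge0 (le_trans _ s1).
- exact: measurable_inv12.
- move=> s /=; rewrite in_itv/= => /andP[s1 _].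
  by rewrite lee_fin invf_le1// (lt_le_trans _ s1).
Qed.

Let harmonic12_lb : ((2^-1)%:E <= \int[leb]_(s in `[1%R, 2%R]) (s^-1)%:E)%E.
Proof.
rewrite -[leLHS]mule1 -leb12 -integral_cst//.
apply: ge0_le_integral => //.
- by move=> s _; rewrite lee_fin invr_ge0.
- exact: measurable_inv12.
- move=> s /=; rewrite in_itv/= => /andP[s1 s2]; rewrite lee_fin lef_pV2// posrE//.
  by rewrite (lt_le_trans _ s1).
Qed.

Lemma harmonic12E :
  (\int[leb]_(s in `[1%R, 2%R]) (s^-1)%:E)%E = harmonic12%:E.
Proof.
rewrite fineK// ge0_fin_numE; first exact: le_lt_trans harmonic12_ub (ltry _).
by apply: le_trans harmonic12_lb; rewrite lee_fin invr_ge0.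
Qed.

Lemma harmonic12_gt0 : 0 < harmonic12.
Proof.
rewrite -lte_fin -harmonic12E; apply: lt_le_trans harmonic12_lb.
by rewrite lte_fin invr_gt0.
Qed.

End harmonic_constant.

Section spectral_integral.
Context {R : realType} (d : nat).
Local Notation V := (@vspace R d).
Variables (L : {finite_measure set V -> \bar R}) (h : R).
Hypothesis h0 : 0 < h.
Hypothesis L_half : forall B : set V, measurable B -> B `<=` far h ->
  L (vscale 2^-1 @^-1` B) = (2^-1%:E * L B)%E.
Implicit Types B : set V.

Local Notation leb := (@lebesgue_measure R).

Definition shell : set V := far h `\` far (2 * h).

Lemma measurable_shell : measurable shell.
Proof. by apply: measurableD; exact: measurable_far. Qed.

Lemma shell_lt (y : V) i : shell y -> y i < 2 * h.
Proof. by move=> [_ yh]; rewrite ltNge; apply/negP => hy; apply: yh; exists i. Qed.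

Let L_pow n B : measurable B -> B `<=` far h ->
  L (vscale (2^-1 ^+ n) @^-1` B) = ((2^-1 ^+ n)%:E * L B)%E.
Proof.
elim: n B => [|n IH] B mB Bh.
  rewrite expr0 mul1e; congr (L _); apply/seteqP; split=> y;
  by rewrite /preimage/= (_ : vscale 1 y = y)//; apply/funext => i; rewrite /vscale mul1r.
have Bn : vscale (2^-1 ^+ n) @^-1` B `<=` far h.
  move=> y /Bh[i hi]; exists i; rewrite /vscale in hi.
  have p0 : (0 : R) < 2^-1 ^+ n by rewrite exprn_gt0// invr_gt0.
  have y0 : 0 < y i by rewrite -(pmulr_rgt0 _ p0) (lt_le_trans h0).
  apply: le_trans hi _; rewrite ler_piMl//; first exact: ltW.
  by rewrite exprn_ile1// invf_le1// ler1n.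
have mBn : measurable (vscale (2^-1 ^+ n) @^-1` B) by exact: measurable_funPTI.
have := L_half mBn Bn; rewrite IH// muleA -EFinM -exprS => <-.
congr (L _); apply/seteqP; split=> y; by rewrite /preimage/= vscaleA -exprSr.
Qed.

Definition maxlin (x : 'rV[R]_d) (y : V) : R := \big[Num.max/0]_i (x 0 i * y i).

Lemma measurable_maxlin x : measurable_fun setT (maxlin x).
Proof.
apply: measurable_bigmax => i; apply: measurable_funM => //.
exact: measurable_coord.
Qed.

Lemma maxlin_ge0 x y : 0 <= maxlin x y.
Proof. exact: bigmax_ge_id. Qed.

Lemma maxlin_scale x a y : 0 <= a -> maxlin x (vscale a y) = a * maxlin x y.
Proof.
move=> a0; rewrite /maxlin; elim/big_ind2: _ => [|u1 u2 v1 v2 -> ->|i _].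
- by rewrite mulr0.
- by rewrite maxr_pMr.
- by rewrite /vscale mulrCA.
Qed.

Lemma maxlin_geP x y s : 0 < s -> s <= maxlin x y <-> exists i, s <= x 0 i * y i.
Proof.
move=> s0; split.
  move=> hs; apply: contrapT => hn; move: hs; apply/negP; rewrite -ltNge.
  apply/bigmax_ltP; split => // i _; rewrite ltNge; apply/negP => hi.
  by apply: hn; exists i.
by move=> [i hi]; apply: le_trans hi _; exact: le_bigmax.
Qed.

Variable x : 'rV[R]_d.
Hypothesis xh : forall i, 0 <= x 0 i <= h^-1.

Lemma level_far s : 1 <= s -> [set y | s <= maxlin x y] `<=` far h.
Proof.
move=> s1 y /=; move/maxlin_geP => [|i hi]; first exact: lt_le_trans s1.
exists i; have /andP[x0 x1] := xh i.
have p0 : 0 < x 0 i * y i by apply: lt_le_trans hi; exact: lt_le_trans s1.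
have y0 : 0 < y i by rewrite ltNge; apply/negP => y0; nra.
have : 1 <= y i / h.
  by rewrite mulrC (le_trans (le_trans s1 hi))// ler_pM2r.
by rewrite ler_pdivlMr// mul1r.
Qed.

Let pow_le n (a b : R) : (a <= 2^-1 ^+ n * b) = (2 ^+ n * a <= b).
Proof. by rewrite exprVn mulrC ler_pdivlMr ?exprn_gt0// mulrC. Qed.

(* The images of the shell under the dilations by 2^n partition far h. *)
Let shell_ n : set V := vscale (2^-1 ^+ n) @^-1` shell.

Let shell_P n (y : V) : shell_ n y <->
  (exists i, 2 ^+ n * h <= y i) /\ (forall i, y i < 2 ^+ n.+1 * h).
Proof.
split=> [[[i hi] yn]|[[i hi] yn]].
  split; first by exists i; rewrite -pow_le.
  move=> j; rewrite ltNge; apply/negP => hj; apply: yn; exists j.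
  by rewrite /vscale pow_le mulrA -exprSr.
split; first by exists i; rewrite /vscale pow_le.
move=> [j]; rewrite /vscale pow_le mulrA -exprSr.
by apply/negP; rewrite -ltNge.
Qed.

Let mshell_ n : measurable (shell_ n).
Proof. by apply: measurable_funPTI; exact: measurable_shell. Qed.

Let shell_triv : trivIset setT shell_.
Proof.
have H n m : (n < m)%N -> forall y, shell_ n y -> shell_ m y -> False.
  move=> nm y /shell_P[_ yn] /shell_P[[i yi] _].
  have := yn i; apply/negP; rewrite -leNgt; apply: le_trans yi.
  by rewrite ler_pM2r// ler_weXn2l// ler1n.
move=> n m _ _ [y [yn ym]]; case: (ltngtP n m) => // nm.
  by case: (H _ _ nm y).
by case: (H _ _ nm y).
Qed.

Let shell_cover : \bigcup_n shell_ n = far h.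
Proof.
apply/seteqP; split=> [y [n _ /shell_P[[i yi] _]]|y [i0 yi0]].
  exists i; apply: le_trans yi; rewrite -[leLHS]mul1r ler_pM2r//.
  by rewrite -[leLHS](expr1n _ n) lerXn2r ?nnegrE ?ler1n.
(* The shell of y is found as the least n with all coordinates below
   2^(n+1) h. *)
pose Q n := [forall i, y i < 2 ^+ n.+1 * h].
have exQ : exists n, Q n.
  pose S := \sum_i `|y i|.
  have S0 : 0 <= S / h by rewrite divr_ge0// ?(ltW h0)// sumr_ge0.
  exists (Num.bound (S / h)); apply/forallP => i.
  have yS : y i <= S.
    by rewrite /S (bigD1 i)//= (le_trans (ler_norm _))// lerDl sumr_ge0.
  apply: le_lt_trans yS _; rewrite -ltr_pdivrMr//.
  apply: lt_le_trans (archi_boundP S0) _.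
  rewrite -natrX ler_nat ltnW// (ltn_trans (ltn_expl _ (ltnSn 1)))//.
  by rewrite ltn_exp2l.
case: (ex_minnP exQ) => -[|n] /forallP Qn nmin.
  exists 0%N => //; apply/shell_P; split=> //.
  by exists i0; rewrite expr0 mul1r.
exists n.+1 => //; apply/shell_P; split=> //.
have : ~~ Q n by apply/negP => /nmin; rewrite ltnn.
by rewrite negb_forall => /existsP[i]; rewrite -leNgt; exists i.
Qed.

(** Averaging the hypothesis over s in [1, 2] turns the level sets into the
    integral of [ramp] of the max-linear function on far h.  By homogeneity its
    part on the n-th dyadic shell is 2^-n times an integral over the first
    shell, and [ramp_dyadic] sums these up to the max-linear function, which is
    less than 2 on that shell. *)
Lemma spectral_integral (q : R) :
  (forall s, 1 <= s <= 2 -> L [set y | s <= maxlin x y] = (q / s)%:E) ->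
  (\int[L]_(y in shell) (maxlin x y)%:E = (harmonic12 * q)%:E)%E.
Proof.
move=> hq.
have mg := measurable_maxlin x.
have mramp (a : R) : measurable_fun setT (fun y => ramp (a * maxlin x y)).
  apply: measurable_funB; apply: measurable_minr => //;
  exact: measurable_funM.
have ramp_ge0 u : 0 <= ramp u :> R.
  by rewrite /ramp; case: (leP u 2); case: (leP u 1); lra.
transitivity (\int[leb]_(s in `[1%R, 2%R])
    L (far h `&` [set y | (s <= maxlin x y)%R]))%E; last first.
  transitivity (\int[leb]_(s in `[1%R, 2%R]) (q%:E * (s^-1)%:E))%E.
    apply: eq_integral => s; rewrite inE/= in_itv/= => s12.
    rewrite setIidr; last by apply: level_far; case/andP: s12.
    by rewrite hq// EFinM.
  have q0 : 0 <= q.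
    have := hq 1; rewrite lexx ler1n/= => /(_ isT) h1.
    by rewrite -lee_fin -[q]divr1 -h1.
  rewrite ge0_integralZl_EFin//; last 2 first.
  - move=> s /=; rewrite in_itv/= => /andP[s1 _].
    by rewrite lee_fin invr_ge0 (le_trans _ s1).
  - exact: measurable_inv12.
  by rewrite harmonic12E -EFinM mulrC.
rewrite integral_levels//; last exact: measurable_far.
rewrite -shell_cover ge0_integral_bigcup//; last 2 first.
- apply: measurable_funTS; apply/measurable_EFinP.
  have := mramp 1; congr (measurable_fun _ _).
  by apply/funext => y; rewrite mul1r.
- by move=> y _; rewrite lee_fin.
transitivity (\sum_(n <oo) \int[L]_(y in shell)
    ((2^-1 ^+ n * ramp (2 ^+ n * maxlin x y))%R)%:E)%E.
  rewrite -integral_nneseries//.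
  - apply: eq_integral => y; rewrite inE => ys; rewrite ramp_dyadic//.
    rewrite maxlin_ge0/=; apply/bigmax_ltP; split=> // i _.
    have yi := shell_lt i ys; have /andP[x0 x1] := xh i.
    case: (leP (y i) 0) => y0; first by rewrite (@le_lt_trans _ _ 0)// mulr_ge0_le0.
    apply: (@le_lt_trans _ _ (h^-1 * y i)); first by rewrite ler_pM2r.
    by rewrite mulrC ltr_pdivrMr.
  - exact: measurable_shell.
  - move=> n; apply: measurable_funTS; apply/measurable_EFinP.
    by apply: measurable_funM => //; exact: mramp.
  - move=> n y _; rewrite lee_fin mulr_ge0// exprn_ge0// invr_ge0//.
apply: eq_eseriesr => n _; apply/esym.
have m2g : measurable_fun setT (fun y => 2 ^+ n * maxlin x y).
  exact: measurable_funM.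
have n0 : (0 : R) <= 2^-1 ^+ n by rewrite exprn_ge0// invr_ge0.
rewrite -integral_levels//.
transitivity ((2^-1 ^+ n)%:E *
    \int[L]_(y in shell) (ramp (2 ^+ n * maxlin x y))%:E)%E; last first.
  rewrite -ge0_integralZl_EFin//; first exact: measurable_shell.
  - by move=> y _; rewrite lee_fin.
  - by apply: measurable_funTS; apply/measurable_EFinP; exact: mramp.
rewrite -integral_levels//; last exact: measurable_shell.
rewrite -ge0_integralZl_EFin//; last first.
  by apply: measurable_funTS; apply: measurable_levels => //; exact: measurable_shell.
apply: eq_integral => s _; rewrite -L_pow; last 2 first.
- apply: measurableI; [exact: measurable_shell|exact: measurable_ge_level].
- by move=> y [[]].
congr (L _); apply/seteqP; split=> y [yn ys]; split => //; move: ys;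
by rewrite /= maxlin_scale// mulrA -exprMn divff// expr1n mul1r.
Qed.

End spectral_integral.

(** * Norms generated by random vectors *)

Section generator_norm.
Context {R : realType} (d : nat) {disp : measure_display}
  {T : measurableType disp} {P : probability T R} (Z : 'I_d -> {RV P >-> R}).
Hypothesis Z0 : forall i w, 0 <= Z i w.
Hypothesis EZ : forall i, ('E_P[Z i] = 1)%E.

Let maxZ (x : 'rV[R]_d) (w : T) : R := \big[Num.max/0]_(i < d) (`|x 0 i| * Z i w).

Definition generated_norm (x : 'rV[R]_d) : R :=
  fine ('E_P[fun w => (\big[Num.max/0]_(i < d) (`|x 0 i| * Z i w))%R])%E.

Let maxZ_ge0 x w : 0 <= maxZ x w. Proof. exact: bigmax_ge_id. Qed.

Let maxZ_ge (x : 'rV[R]_d) i w : `|x 0 i| * Z i w <= maxZ x w.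
Proof. exact: (le_bigmax 0 (fun i => `|x 0 i| * Z i w) i). Qed.

Let maxZ_le (x : 'rV[R]_d) w b : 0 <= b ->
  (forall i, `|x 0 i| * Z i w <= b) -> maxZ x w <= b.
Proof. by move=> b0 hb; apply/bigmax_leP; split. Qed.

Let mZ x : measurable_fun setT (fun w => (maxZ x w)%:E).
Proof.
apply/measurable_EFinP; apply: measurable_bigmax => i.
exact: measurable_funM.
Qed.

Let mZi i (b : R) : measurable_fun setT (fun w => (b * Z i w)%:E).
Proof. by apply/measurable_EFinP; apply: measurable_funM. Qed.

Let int_Zi i b : 0 <= b -> (\int[P]_w (b * Z i w)%:E = b%:E)%E.
Proof.
move=> b0; under eq_integral do rewrite EFinM.
rewrite ge0_integralZl_EFin//.
- by have := EZ i; rewrite expectation_def => ->; rewrite mule1.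
- by move=> w _; rewrite lee_fin.
- exact/measurable_EFinP.
Qed.

Let int_ge0 x : (0 <= \int[P]_w (maxZ x w)%:E)%E.
Proof. by apply: integral_ge0 => w _; rewrite lee_fin. Qed.

Lemma generated_normE x : ((generated_norm x)%:E =
  'E_P[fun w => (\big[Num.max/0]_(i < d) (`|x 0 i| * Z i w))%R])%E.
Proof.
rewrite /generated_norm fineK// unlock ge0_fin_numE; last exact: int_ge0.
apply: (@le_lt_trans _ _ (\int[P]_w (\sum_i (`|x 0 i| * Z i w)%:E))%E).
  apply: ge0_le_integral => //.
  - by move=> w _; rewrite lee_fin; exact: maxZ_ge0.
  - exact: mZ.
  - by apply: emeasurable_sum => i; exact: mZi.
  - move=> w _; rewrite sumEFin lee_fin; apply: maxZ_le.
      by apply: sumr_ge0 => i _; rewrite mulr_ge0.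
    move=> i; rewrite (bigD1 i)//= lerDl; apply: sumr_ge0 => j _.
    by rewrite mulr_ge0.
rewrite ge0_integral_sum//.
- by under eq_bigr do rewrite int_Zi//; rewrite sumEFin ltry.
- by move=> i w _; rewrite lee_fin mulr_ge0.
Qed.

Let generated_int x : (generated_norm x)%:E = (\int[P]_w (maxZ x w)%:E)%E.
Proof. by rewrite generated_normE unlock. Qed.

(** Definiteness comes from E(Z_i) = 1, which bounds |x_i| by the norm of x. *)
Lemma generated_norm_is_norm : is_norm generated_norm.
Proof.
split.
- by move=> x; rewrite -lee_fin generated_int.
- move=> x Nx; apply/rowP => i; rewrite mxE; apply/normr0_eq0/eqP.
  rewrite eq_le normr_ge0 andbT -lee_fin -Nx generated_int -(int_Zi i)//.
  apply: ge0_le_integral => //.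
  - by move=> w _; rewrite lee_fin mulr_ge0.
  - by move=> w _; rewrite lee_fin; exact: maxZ_ge.
- move=> a x; apply: EFin_inj; rewrite EFinM !generated_int.
  rewrite -ge0_integralZl_EFin//; last by move=> w _; rewrite lee_fin; exact: maxZ_ge0.
  apply: eq_integral => w _; rewrite -EFinM; congr EFin.
  rewrite /maxZ; elim/big_ind2: _ => [|u1 u2 v1 v2 -> ->|i _].
  + by rewrite mulr0.
  + by rewrite maxr_pMr.
  + by rewrite mxE normrM mulrA.
- move=> x y; rewrite -lee_fin EFinD !generated_int -ge0_integralD//;
    try by move=> w _; rewrite lee_fin; exact: maxZ_ge0.
  apply: ge0_le_integral => //.
  - by move=> w _; rewrite lee_fin; exact: maxZ_ge0.
  - exact: emeasurable_funD.
  - move=> w _; rewrite -EFinD lee_fin; apply: maxZ_le; first exact: addr_ge0.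
    move=> i; apply: le_trans (lerD (maxZ_ge x i w) (maxZ_ge y i w)).
    by rewrite -mulrDl ler_wpM2r// mxE ler_normD.
Qed.

Lemma generated_Dnorm : is_Dnorm generated_norm.
Proof.
split; first exact: generated_norm_is_norm.
by exists disp, T, P, Z; split => // x; exact: generated_normE.
Qed.

End generator_norm.

(** * Truncated reciprocals of an exceedance stable vector *)

Section reciprocal_vector.
Context {R : realType} (d : nat) {disp : measure_display}
  {T : measurableType disp} {P : probability T R} (U : 'I_d -> {RV P >-> R}).
Hypothesis uU : forall i, uniform01 (U i).
Variable e : R.
Hypothesis e0 : 0 < e.
Local Notation V := (@vspace R d).

(** Coordinates with 1 - U_i outside ]0, e] are recorded as 0, because homogeneity
    holds only within that range. *)
Definition reciprocal (w : T) : V := fun i =>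
  if 0 < 1 - U i w <= e then (1 - U i w)^-1 else 0.

Lemma reciprocal_ge0 w i : 0 <= reciprocal w i.
Proof.
by rewrite /reciprocal; case: ifP => // /andP[h _]; rewrite invr_ge0 ltW.
Qed.

(** The two sides agree also when the coordinate has been recorded as 0, because z
    does not exceed e. *)
Lemma reciprocal_mul z w i : 0 <= z <= e ->
  (1 <= z * reciprocal w i) = (0 < 1 - U i w <= z).
Proof.
move=> /andP[z0 ze]; rewrite /reciprocal; case: ifP => [/andP[h1 h2]|].
  by rewrite ler_pdivlMr// mul1r h1.
rewrite mulr0 ler10 => /negbT; rewrite negb_and => /orP[/negbTE->//|h].
apply/esym/negbTE; rewrite negb_and; apply/orP; right.
by apply: contra h => h; exact: le_trans ze.
Qed.

Lemma reciprocal_ge r w i : e^-1 <= r ->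
  (r <= reciprocal w i) = (0 < 1 - U i w <= r^-1).
Proof.
move=> er; have r0 : 0 < r by apply: lt_le_trans er; rewrite invr_gt0.
rewrite -reciprocal_mul; last first.
  by rewrite invr_ge0 ltW//= -[leRHS]invrK lef_pV2// posrE invr_gt0.
by rewrite mulrC ler_pdivlMr// mul1r.
Qed.

Lemma measurable_dist_itv i (z : R) : measurable [set w | 0 < 1 - U i w <= z].
Proof.
rewrite (_ : [set w | _] = U i @^-1` `[1 - z, 1[); first exact: measurable_funPTI.
by apply/seteqP; split=> w /=; rewrite in_itv/= => /andP[? ?]; apply/andP; split; lra.
Qed.

Lemma measurable_reciprocal : measurable_fun setT reciprocal.
Proof.
apply: measurable_vector => i; rewrite /reciprocal.
apply: (measurability (@measurable_realfun.RGenCInfty.G R)).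
  exact: measurable_realfun.RGenCInfty.measurableE.
move=> _ [_ [r ->] <-]; rewrite setTI.
have [r0|r0] := leP r 0.
  rewrite (_ : _ @^-1` _ = setT)//; apply/seteqP; split=> // w _ /=.
  by rewrite in_itv/= andbT (le_trans r0)//; exact: reciprocal_ge0.
have [re|re] := leP e^-1 r.
  rewrite (_ : _ @^-1` _ = [set w | 0 < 1 - U i w <= r^-1]).
    exact: measurable_dist_itv.
  apply/seteqP; split=> w /=; rewrite in_itv/= andbT -reciprocal_ge//.
rewrite (_ : _ @^-1` _ = [set w | 0 < 1 - U i w <= e]).
  exact: measurable_dist_itv.
apply/seteqP; split=> w /=; rewrite in_itv/= andbT.
  by case: ifP => [_ _ //|_]; rewrite leNgt r0.
move=> h; rewrite h; move/andP: h => [h1 h2].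
by rewrite (le_trans (ltW re))// lef_pV2// posrE.
Qed.

HB.instance Definition _ :=
  isMeasurableFun.Build _ _ _ _ reciprocal measurable_reciprocal.

Let ae_lt1 : {ae P, forall w i, 0 < 1 - U i w}.
Proof.
apply: ae_forall_fin => i.
apply: filterS2 (uniform01_ae_le1 (uU i)) (uniform01_neq 1 (uU i)).
by move=> w h1 h2; rewrite subr_gt0 lt_neqAle h2.
Qed.

Lemma reciprocal_all (z : 'rV[R]_d) (A : seq 'I_d) : (forall i, 0 <= z 0 i <= e) ->
  P [set w | forall i, i \in A -> 1 <= z 0 i * reciprocal w i] =
  (pbox U z A [::])%:E.
Proof.
move=> ze; rewrite -pboxE; apply: measure_ae_eq.
- apply: measurable_forall_fin => i; case: (i \in A); last first.
    by rewrite (_ : (fun w => _) = setT)//; apply/seteqP; split.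
  rewrite (_ : (fun w => _) = [set w | 0 < 1 - U i w <= z 0 i]).
    exact: measurable_dist_itv.
  by apply/seteqP; split=> w /=; rewrite -reciprocal_mul//; apply.
- exact: measurable_box.
- move: ae_lt1; apply: filterS => w h /=; split=> hw i.
    by split=> // iA; have := hw i iA; rewrite reciprocal_mul// => /andP[_]; lra.
  by move=> iA; rewrite reciprocal_mul// h/=; have [/(_ iA) + _] := hw i; lra.
Qed.

(** The probability that 1 - U_i <= z_i for some i. *)
Definition tail (z : 'rV[R]_d) : R := 1 - pbox U z [::] (enum 'I_d).

Lemma measurable_reciprocal_some (z : 'rV[R]_d) : (forall i, 0 <= z 0 i <= e) ->
  measurable [set w | exists i, 1 <= z 0 i * reciprocal w i].
Proof.
move=> ze.
apply: (@measurable_exists_fin _ _ _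
  (fun i => [set w | 1 <= z 0 i * reciprocal w i])) => i.
rewrite (_ : [set w | _] = [set w | 0 < 1 - U i w <= z 0 i]).
  exact: measurable_dist_itv.
by apply/seteqP; split=> w /=; rewrite reciprocal_mul.
Qed.

Lemma reciprocal_some (z : 'rV[R]_d) : (forall i, 0 <= z 0 i <= e) ->
  P [set w | exists i, 1 <= z 0 i * reciprocal w i] = (tail z)%:E.
Proof.
move=> ze; rewrite /tail EFinB -pboxE -probability_setC; last exact: measurable_box.
apply: measure_ae_eq; first exact: measurable_reciprocal_some.
  by apply: measurableC; exact: measurable_box.
move: ae_lt1; apply: filterS => w h /=; split.
  move=> [i]; rewrite reciprocal_mul// => /andP[_ hi] /(_ i)[_].
  by rewrite mem_enum => /(_ isT); lra.
move=> hb; apply: contrapT => hn; apply: hb => i; split=> // _.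
rewrite ltNge; apply/negP => hi; apply: hn; exists i.
by rewrite reciprocal_mul// h/=; lra.
Qed.

Hypothesis pbox_hom :
  forall t (x : 'rV[R]_d), 0 <= t <= 1 -> (forall i, 0 <= x 0 i <= e) ->
    forall a A, pbox U (t *: x) (a :: A) [::] = t * pbox U x (a :: A) [::].

Lemma tail_hom t (x : 'rV[R]_d) : 0 <= t <= 1 -> (forall i, 0 <= x 0 i <= e) ->
  tail (t *: x) = t * tail x.
Proof.
move=> t01 xe; rewrite /tail (box_homogeneous_lt (pbox_hom t01 xe)); lra.
Qed.

Let half_box (x : 'rV[R]_d) : (forall i, 0 <= x 0 i <= e) ->
  forall i, 0 <= (2^-1 *: x) 0 i <= e.
Proof. by move=> xe i; rewrite mxE; have /andP[? ?] := xe i; apply/andP; split; lra. Qed.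

Let mu0 : probability V R := distribution P reciprocal.

Let halve_ge (y : V) i r : 0 < r ->
  (r <= halve e^-1 y i) = (1 <= 2^-1 * (Num.max e^-1 r)^-1 * y i).
Proof.
move=> r0; have m0 : 0 < Num.max e^-1 r by rewrite lt_max r0 orbT.
rewrite -invfM mulrC ler_pdivlMr ?mulr_gt0// mul1r /halve.
rewrite !(mulrC 2) -!ler_pdivlMr// ge_max.
by case: ifP => _ //=; rewrite leNgt r0.
Qed.

(* Nonzero coordinates are at least 1/e, so positive thresholds can be raised to
   1/e. *)
Let reciprocal_threshold w i r : 0 < r ->
  (r <= reciprocal w i) = (1 <= (Num.max e^-1 r)^-1 * reciprocal w i).
Proof.
move=> r0; have m0 : 0 < Num.max e^-1 r by rewrite lt_max r0 orbT.
rewrite mulrC ler_pdivlMr// mul1r ge_max.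
case: leP => h /=; rewrite ?andbF// andbT; apply/esym.
move: (lt_le_trans r0 h); rewrite /reciprocal; case: ifP => [/andP[h1 h2] _|_].
  by rewrite lef_pV2// posrE.
by rewrite ltxx.
Qed.

Let neq0_ge (y : R) : 0 <= y -> (y != 0) = (0 < y).
Proof. by rewrite lt0r => ->; rewrite andbT. Qed.

Let halve_neq0 (y : V) i : (halve e^-1 y i != 0) = (1 <= 2^-1 * e * y i).
Proof.
have e1 : 0 < e^-1 by rewrite invr_gt0.
rewrite -[in RHS](invrK e) -invfM mulrC ler_pdivlMr ?mulr_gt0// mul1r /halve.
case: ifP => h; last by rewrite eqxx.
by rewrite gt_eqF// divr_gt0// (lt_le_trans _ h)// mulr_gt0.
Qed.

Let reciprocal_neq0 w i : (reciprocal w i != 0) = (1 <= e * reciprocal w i).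
Proof.
rewrite reciprocal_mul; last by rewrite lexx ltW.
rewrite /reciprocal; case: ifP => [/andP[h _]|_].
  by rewrite gt_eqF// invr_gt0.
by rewrite eqxx.
Qed.

(** It suffices to compare both sides on the orthants, intersected with the
    nonzero vectors.  An orthant with a positive threshold is a box with A
    nonempty, whose probability is halved with its corner; any other orthant
    contains all nonnegative vectors, and homogeneity of [tail] applies. *)
Lemma reciprocal_halve (B : set V) : measurable B -> ~ B (fun=> 0) ->
  mu0 (halve e^-1 @^-1` B) = (2^-1%:E * mu0 B)%E.
Proof.
move=> mB B0.
pose N0 : set V := [set y | exists i, y i != 0].
have mN0 : measurable N0.
  by apply: measurable_exists_fin => i; exact: measurable_coord_neq0.
pose m1 : {measure set V -> \bar R} := mrestr (distribution mu0 (halve e^-1)) mN0.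
have half0 : (0 : R) <= 2^-1 by rewrite invr_ge0.
pose m2 : {measure set V -> \bar R} := mscale (NngNum half0) (mrestr mu0 mN0).
have BN0 : B `&` N0 = B.
  apply/setIidPl => y By; apply: contrapT => yN; apply: B0.
  rewrite (_ : (fun=> 0) = y)//; apply/funext => i; apply/esym/eqP.
  by rewrite -[_ == _]negbK; apply/negP => h; apply: yN; exists i.
suff : m1 B = m2 B.
  have m1E : m1 B = mu0 (halve e^-1 @^-1` B) by rewrite -[in RHS]BN0.
  have m2E : m2 B = (2^-1%:E * mu0 B)%E by rewrite -[in RHS]BN0.
  by rewrite m1E m2E.
apply: (@g_sigma_algebra_measure_unique _ R V (@orthants R d) _ (fun=> setT)).
- by move=> X; exact: sub_sigma_algebra.
- by move=> _; exists finset.set0, (fun=> 0); apply/seteqP; split=> // y _ i; rewrite inE.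
- by apply/seteqP; split=> // y _; exists 0%N.
- exact: orthantsI.
- move=> _ [A [c ->]].
  pose O : set V := [set y | forall i, i \in A -> c i <= y i].
  have -> : m1 O = P [set w | O (halve e^-1 (reciprocal w)) /\
                              N0 (halve e^-1 (reciprocal w))] by [].
  have -> : m2 O = (2^-1%:E * P [set w | O (reciprocal w) /\
                              N0 (reciprocal w)])%E by [].
  have halve_ge0 w i : 0 <= halve e^-1 (reciprocal w) i.
    by rewrite /halve; case: ifP => // _; rewrite divr_ge0// reciprocal_ge0.
  have [[a aA ca]|noA] := pselect (exists2 a, a \in A & 0 < c a).
    pose z : 'rV[R]_d := \row_i (Num.max e^-1 (c i))^-1.
    have ze i : 0 <= z 0 i <= e.
      have m0 : 0 < Num.max e^-1 (c i) by rewrite lt_max invr_gt0 e0.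
      rewrite mxE invr_ge0 ltW//= -[leRHS]invrK lef_pV2 ?posrE ?invr_gt0//.
      by rewrite le_max lexx.
    pose s := [seq i <- enum A | 0 < c i].
    have sA i : (i \in s) = (0 < c i) && (i \in A).
      by rewrite mem_filter mem_enum.
    have -> : [set w | O (halve e^-1 (reciprocal w)) /\
                       N0 (halve e^-1 (reciprocal w))] =
        [set w | forall i, i \in s -> 1 <= (2^-1 *: z) 0 i * reciprocal w i].
      apply/seteqP; split=> w /=.
        move=> [h _] i; rewrite sA => /andP[ci iA].
        by have := h i iA; rewrite halve_ge// !mxE.
      move=> h; have hO : O (halve e^-1 (reciprocal w)).
        move=> i iA; have [ci|ci] := ltP 0 (c i); last exact: le_trans ci _.
        by rewrite halve_ge//; have := h i; rewrite sA ci iA !mxE; apply.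
      split=> //; exists a; rewrite neq0_ge//.
      exact: lt_le_trans ca (hO a aA).
    have -> : [set w | O (reciprocal w) /\ N0 (reciprocal w)] =
        [set w | forall i, i \in s -> 1 <= z 0 i * reciprocal w i].
      apply/seteqP; split=> w /=.
        move=> [h _] i; rewrite sA => /andP[ci iA].
        by have := h i iA; rewrite reciprocal_threshold// !mxE.
      move=> h; have hO : O (reciprocal w).
        move=> i iA; have [ci|ci] := ltP 0 (c i).
          by rewrite reciprocal_threshold//; have := h i; rewrite sA ci iA !mxE; apply.
        by rewrite (le_trans ci)// reciprocal_ge0.
      split=> //; exists a; rewrite neq0_ge ?reciprocal_ge0//.
      exact: lt_le_trans ca (hO a aA).
    rewrite !reciprocal_all//; last exact: half_box.
    have : a \in s by rewrite sA ca.
    case: (s) => // b s' _; rewrite pbox_hom ?EFinM//.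
    by rewrite half0 invf_le1// ler1n.
  have cle0 i : i \in A -> c i <= 0.
    by move=> iA; rewrite leNgt; apply/negP => ci; apply: noA; exists i.
  pose z : 'rV[R]_d := const_mx e.
  have ze i : 0 <= z 0 i <= e by rewrite mxE lexx ltW.
  have -> : [set w | O (halve e^-1 (reciprocal w)) /\
                     N0 (halve e^-1 (reciprocal w))] =
      [set w | exists i, 1 <= (2^-1 *: z) 0 i * reciprocal w i].
    apply/seteqP; split=> w /=.
      by move=> [_ [i]]; rewrite halve_neq0 => hi; exists i; rewrite !mxE.
    move=> [i]; rewrite !mxE -halve_neq0 => hi; split; last by exists i.
    by move=> j /cle0 /le_trans; apply.
  have -> : [set w | O (reciprocal w) /\ N0 (reciprocal w)] =
      [set w | exists i, 1 <= z 0 i * reciprocal w i].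
    apply/seteqP; split=> w /=.
      by move=> [_ [i]]; rewrite reciprocal_neq0 => hi; exists i; rewrite !mxE.
    move=> [i]; rewrite !mxE -reciprocal_neq0 => hi; split; last by exists i.
    by move=> j /cle0 /le_trans; apply; exact: reciprocal_ge0.
  rewrite !reciprocal_some//; last exact: half_box.
  by rewrite tail_hom ?EFinM// half0 invf_le1// ler1n.
- move=> _; have -> : m1 setT = mu0 (halve e^-1 @^-1` (setT `&` N0)) by [].
  by rewrite ltey_eq fin_num_measure//; apply: measurable_funPTI; exact: measurableI.
- exact: mB.
Qed.

End reciprocal_vector.

(** * The generator of an exceedance stable vector *)

Section spectral_coordinate.
Context {R : realType} (d : nat).
Local Notation V := (@vspace R d).
Variables (h k : R).
Hypothesis k0 : 0 <= k.

Definition spectral_coord i (y : V) : R :=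
  k * (\1_(@shell R d h) y * Num.max (y i) 0).

Lemma measurable_spectral_coord i : measurable_fun setT (spectral_coord i).
Proof.
apply: measurable_funM => //; apply: measurable_funM.
  exact: measurable_indic (measurable_shell _).
by apply: measurable_maxr => //; exact: measurable_coord.
Qed.

HB.instance Definition _ i :=
  isMeasurableFun.Build _ _ _ _ (spectral_coord i) (measurable_spectral_coord i).

Lemma spectral_coord_ge0 i y : 0 <= spectral_coord i y.
Proof. by rewrite !mulr_ge0// le_max lexx orbT. Qed.

Lemma bigmax_spectral_coord (x : 'rV[R]_d) y : (forall i, 0 <= x 0 i) ->
  \big[Num.max/0]_(i < d) (`|x 0 i| * spectral_coord i y) =
  k * (\1_(@shell R d h) y * maxlin x y).
Proof.
move=> x0; rewrite /maxlin.
have -> : \big[Num.max/0]_i (x 0 i * y i) =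
          \big[Num.max/0]_(i < d) (x 0 i * Num.max (y i) 0).
  apply/eqP; rewrite eq_le; apply/andP; split; apply/bigmax_leP; split;
    rewrite ?bigmax_ge_id// => i _.
    apply: le_trans (le_bigmax _ _ i); apply: ler_wpM2l => //.
    by rewrite le_max lexx.
  rewrite maxr_pMr// mulr0 ge_max bigmax_ge_id andbT.
  exact: (le_bigmax _ (fun i => x 0 i * y i)).
elim/big_ind2: _ => [|u1 u2 v1 v2 -> ->|i _]; first by rewrite !mulr0.
  by rewrite !maxr_pMr.
by rewrite /spectral_coord ger0_norm//; ring.
Qed.

End spectral_coordinate.

Section stable_generator.
Context {R : realType} (d : nat) {disp : measure_display}
  {T : measurableType disp} {P : probability T R} (U : 'I_d -> {RV P >-> R}).
Hypothesis uU : forall i, uniform01 (U i).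
Variable e : R.
Hypotheses (e0 : 0 < e) (e1 : e < 1).
Hypothesis pbox_hom :
  forall t (x : 'rV[R]_d), 0 <= t <= 1 -> (forall i, 0 <= x 0 i <= e) ->
    forall a A, pbox U (t *: x) (a :: A) [::] = t * pbox U x (a :: A) [::].
Local Notation V := (@vspace R d).

Lemma tail_joint_cdf (x : 'rV[R]_d) :
  joint_cdf U (const_mx 1 - x) = (1 - tail U x)%:E.
Proof.
rewrite /tail subKr pbox_joint_cdf//; congr (joint_cdf U (_ - _)).
by apply/rowP => j; rewrite mxE mem_enum.
Qed.

(** The tail in a coordinate direction is a margin, which is uniform. *)
Lemma tail_single i a : 0 <= a <= 1 -> tail U (a *: delta_mx 0 i) = a.
Proof.
move=> a01; set x := a *: _.
have xE j : x 0 j = if j == i then a else 0.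
  by rewrite !mxE/=; case: (j == i); rewrite ?mulr1 ?mulr0.
have : pbox U x [::] (enum 'I_d) = pbox U x [::] [:: i].
  apply: EFin_inj; rewrite !pbox_joint_cdf//; congr (joint_cdf U (_ - _)).
  by apply/rowP => j; rewrite mxE [RHS]mxE mem_enum !inE xE; case: (j == i).
rewrite /tail => ->; have := pbox_split U x [::] [::] i; rewrite pbox_nil => ->.
rewrite addrK; apply: EFin_inj; rewrite -pboxE -(uniform01_ge a01 (uU i)).
congr (P _); apply/seteqP; split=> w /=.
  by move=> /(_ i)[+ _]; rewrite inE eqxx xE eqxx; apply.
by move=> h j; split => //; rewrite inE => /eqP ->; rewrite xE eqxx.
Qed.

Let h0 : 0 < e^-1. Proof. by rewrite invr_gt0. Qed.

Let xh (x : 'rV[R]_d) : (forall i, 0 <= x 0 i <= e) ->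
  forall i, 0 <= x 0 i <= e^-1^-1.
Proof. by move=> xe i; rewrite invrK. Qed.

(** The level sets of a max-linear function are the events measured by [tail],
    which is homogeneous. *)
Lemma stable_exponent_measure : exists L : {finite_measure set V -> \bar R},
  (forall B, measurable B -> B `<=` far e^-1 ->
        L (vscale 2^-1 @^-1` B) = (2^-1%:E * L B)%E) /\
  (forall x : 'rV[R]_d, (forall i, 0 <= x 0 i <= e) ->
    forall s, 1 <= s -> L [set y | s <= maxlin x y] = (tail U x / s)%:E).
Proof.
have [L [Lhalf Lval]] :=
  exponent_measure h0 (@reciprocal_halve _ _ _ _ _ _ uU _ e0 pbox_hom).
exists L; split => // x xe s s1; have s0 : 0 < s by apply: lt_le_trans s1.
have s01 : 0 <= s^-1 <= 1 by rewrite invr_ge0 ltW//= invf_le1.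
apply: Lval; first exact: measurable_ge_level (measurable_maxlin x) s.
  exact: (level_far h0 (xh xe) s1).
move=> n; have n01 : (0 : R) <= 2^-1 ^+ n * s^-1 <= 1.
  have /andP[a0 a1] := s01.
  have b0 : (0 : R) <= 2^-1 ^+ n by rewrite exprn_ge0// invr_ge0.
  have b1 : 2^-1 ^+ n <= 1 :> R by rewrite exprn_ile1 ?invr_ge0// invf_le1// ler1n.
  by rewrite mulr_ge0//= mulr_ile1.
transitivity ((tail U ((2^-1 ^+ n * s^-1) *: x))%:E); last first.
  by rewrite (tail_hom pbox_hom n01 xe); congr EFin; ring.
rewrite -(@reciprocal_some _ _ _ _ _ _ uU e); last first.
  move=> i; rewrite mxE; have /andP[x0 x1] := xe i; have /andP[b0 b1] := n01.
  by rewrite mulr_ge0//= (le_trans _ x1)// ler_piMl.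
congr (P _); apply/seteqP; split=> w /=.
  move=> /(maxlin_geP x _ s0)[i hi]; exists i; rewrite mxE.
  move: hi; rewrite /vscale -[X in X <= _ -> _]mulr1 -ler_pdivlMl//.
  by congr (_ <= _); ring.
move=> [i hi]; apply/(maxlin_geP x _ s0); exists i; move: hi; rewrite mxE.
rewrite /vscale -[X in _ -> X <= _]mulr1 -ler_pdivlMl//.
by congr (_ <= _); ring.
Qed.

Hypothesis hd : (0 < d)%N.

(** The exponent measure is normalized to a probability and the factor
    k = L(V) / ln 2 compensates both this and the constant of
    [spectral_integral]. *)
Lemma stable_generator : exists (P1 : probability V R)
    (Z : 'I_d -> {RV P1 >-> R}),
  (forall i y, 0 <= Z i y) /\
  (forall x : 'rV[R]_d, (forall i, 0 <= x 0 i <= e) ->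
    ('E_P1[fun y => (\big[Num.max/0]_(i < d) (`|x 0 i| * Z i y))%R] =
    (tail U x)%:E)%E).
Proof.
have [L [Lhalf Llevel]] := stable_exponent_measure.
have [a a0 La] : exists2 a, 0 < a & L setT = a%:E.
  exists (fine (L setT)); last by rewrite fineK// fin_num_measure.
  (* A half-space in a coordinate direction has mass e > 0. *)
  pose i0 := Ordinal hd; pose x : 'rV[R]_d := e *: delta_mx 0 i0.
  have xe i : 0 <= x 0 i <= e.
    rewrite !mxE/=; case: (_ == _); rewrite ?mulr1 ?mulr0 ?lexx ltW//.
  have := Llevel x xe 1 (lexx 1); rewrite divr1 tail_single ?(ltW e0) ?(ltW e1)// => Lx.
  rewrite -lte_fin fineK ?fin_num_measure//.
  apply: (@lt_le_trans _ _ e%:E); first by rewrite lte_fin.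
  rewrite -Lx; apply: le_measure; rewrite ?inE//.
  exact: measurable_ge_level (measurable_maxlin x) 1.
have c0 := @harmonic12_gt0 R.
pose P1 : probability V R := mnormalize L (\d_(point : V)).
pose k := a / harmonic12.
have k0 : 0 <= k by rewrite divr_ge0 ?ltW.
pose Z : 'I_d -> {RV P1 >-> R} := fun i => @spectral_coord R d e^-1 k i.
exists P1, Z; split=> [i y|x xe]; first exact: spectral_coord_ge0.
have x0 i : 0 <= x 0 i by have /andP[] := xe i.
have mmax := measurable_maxlin x.
have mI : measurable_fun setT (fun y => \1_(@shell R d e^-1) y * maxlin x y).
  apply: measurable_funM => //.
  exact: measurable_indic (measurable_shell _).
have I0 y : 0 <= \1_(@shell R d e^-1) y * maxlin x y.
  by rewrite mulr_ge0// maxlin_ge0.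
have a1 : 0 <= a^-1 by rewrite invr_ge0 ltW.
rewrite unlock (@eq_measure_integral _ _ _ _ (mscale (NngNum a1) L)); last first.
  move=> B mB _; rewrite /P1/= /mnormalize/=.
  rewrite (La : L [set: g_sigma_algebraType (@orthants R d)] = _) eqe (gt_eqF a0)/=.
  by rewrite /mscale/= muleC.
rewrite ge0_integral_mscale//; last 2 first.
- apply/measurable_EFinP.
  rewrite (_ : (fun y => _) =
      (fun y => k * (\1_(@shell R d e^-1) y * maxlin x y))).
    exact: measurable_funM.
  by apply/funext => y; exact: bigmax_spectral_coord.
- by move=> y _; rewrite lee_fin; exact: bigmax_ge_id.
rewrite (eq_integral (fun y => k%:E *
    (\1_(@shell R d e^-1) y * maxlin x y)%:E)%E); last first.
  by move=> y _; rewrite -EFinM; congr EFin; exact: bigmax_spectral_coord.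
rewrite ge0_integralZl_EFin//; last 2 first.
- by move=> y _; rewrite lee_fin.
- exact/measurable_EFinP.
have -> : (\int[L]_y (\1_(@shell R d e^-1) y * maxlin x y)%:E =
  \int[L]_(y in @shell R d e^-1) (maxlin x y)%:E)%E.
  rewrite [RHS]integral_mkcond; apply: eq_integral => y _.
  by rewrite patchE indicE; case: ifPn => _; rewrite ?mul1r ?mul0r.
rewrite (spectral_integral h0 Lhalf (xh xe) (q := tail U x)); last first.
  by move=> s /andP[s1 _]; exact: Llevel.
rewrite -!EFinM; congr EFin => /=; rewrite /k; field.
by rewrite !gt_eqF.
Qed.

End stable_generator.

(** * The characterization *)

(** The normalization E(Z_i) = 1 is the identity E(max x_j Z_j) = tail(x) for x on
    the i-th axis, and the form of C near 1 is the same identity for general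
    x. *)
Lemma exceedance_stable_gpc (R : realType) (d : nat) (hd : (0 < d)%N)
    (disp : measure_display) (T : measurableType disp) (P : probability T R)
    (U : 'I_d -> {RV P >-> R}) (C : 'rV[R]_d -> R) :
  is_copula C -> (forall u, joint_cdf U u = (C u)%:E) ->
  (forall i, uniform01 (U i)) ->
  (forall S : {set 'I_d}, S != finset.set0 ->
     exceedance_stable (subvector U S)) ->
  is_GPC C.
Proof.
move=> hC hU uU hS; split=> //.
have [e [e0 e1 hom]] := exceedance_stable_pbox hS.
have [P1 [Z [Z0 EZ]]] := stable_generator uU e0 e1 hom hd.
have EZ1 i : ('E_P1[Z i] = 1)%E.
  pose x : 'rV[R]_d := e *: delta_mx 0 i.
  have xE j : x 0 j = if j == i then e else 0.
    by rewrite !mxE/=; case: (j == i); rewrite ?mulr1 ?mulr0.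
  have xe j : 0 <= x 0 j <= e by rewrite xE; case: ifP; rewrite ?lexx ltW.
  have := EZ x xe; rewrite tail_single ?ltW ?e0 ?e1//.
  rewrite unlock (eq_integral (fun y => e%:E * (Z i y)%:E)%E); last first.
    move=> y _; rewrite -EFinM; congr EFin.
    have Zi0 : 0 <= e * Z i y by rewrite mulr_ge0// ltW.
    apply/eqP; rewrite eq_le; apply/andP; split.
      apply/bigmax_leP; split=> // j _; rewrite xE.
      case: eqP => [->|_]; first by rewrite ger0_norm ?(ltW e0).
      by rewrite normr0 mul0r.
    apply: le_trans (le_bigmax _ _ i).
    by rewrite xE eqxx ger0_norm// ltW.
  rewrite ge0_integralZl_EFin//; last 3 first.
  - by move=> y _; rewrite lee_fin.
  - exact/measurable_EFinP.
  - exact: ltW.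
  move=> /(congr1 (fun r => (e^-1)%:E * r)%E).
  by rewrite muleA -!EFinM mulVf ?gt_eqF// mul1e.
exists (generated_norm Z), (const_mx (1 - e)); split.
- exact: generated_Dnorm.
- by move=> i; rewrite mxE subr_gt0 e1 ltrBlDr ltrDl.
- move=> u hu; apply: EFin_inj.
  have xe i : 0 <= (const_mx 1 - u) 0 i <= e.
    have := hu i; rewrite !mxE => /andP[? ?]; apply/andP; split; lra.
  rewrite EFinB generated_normE// EZ// -EFinB -tail_joint_cdf// -hU.
  by rewrite opprB addrCA subrr addr0.
Qed.

Local Close Scope classical_set_scope.
Theorem theorem4p1 (R : realType) (d : nat) (hd : (0 < d)%N)
    (disp : measure_display) (Omega : measurableType disp)
    (P : probability Omega R) (U : 'I_d -> {RV P >-> R})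
    (C : 'rV[R]_d -> R)
    (hC : is_copula C)
    (hU : forall u : 'rV[R]_d, joint_cdf U u = (C u)%:E) :
  is_GPC C <->
  (forall T : {set 'I_d}, T != finset.set0 ->
     exceedance_stable (subvector U T)).
Proof.
have uU := copula_margins hC hU.
split; first exact: gpc_exceedance_stable uU _ hU.
exact: exceedance_stable_gpc hd _ _ _ _ _ hC hU uU.
Qed.
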